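(* Let $V_{kv}$ be the vector space spanned by all polynomials $F\in\mathrm{Lie}_n[x,y]$, for $n\ge3$, such that, writing $F=F_xx+F_yy$, we have (i) $F_y$ is antipalindromic, or equivalently, $F$ is push-invariant; (ii) $F_y-F_x$ is push-constant. For each such $F$, write $F=xF^x+yF^y$ and set $G=s(F^x)$. Then the map $F\mapsto D_{F,G}$ extends to a vector space isomorphism $$V_{kv}\;\xrightarrow{\ \sim\ }\;\mathfrak{krv}_2,$$ where $\mathfrak{krv}_2$ is the Kashiwara-Vergne Lie algebra.
   Context: $\mathbb{Q}\langle x,y\rangle$ is the ring of polynomials in non-commuting variables $x,y$; $\mathrm{Lie}_n[x,y]$ is the space of Lie polynomials homogeneous of degree $n$, and $\mathrm{Lie}[x,y]$ is the free Lie algebra. $(f|w)$ denotes the coefficient of the monomial $w$ in $f$. Every polynomial $F$ without constant term is written uniquely as $F=F_xx+F_yy=xF^x+yF^y$. Operators, defined on monomials and extended linearly: $anti(x^{a_0}y\cdots yx^{a_{r-1}}yx^{a_r})=x^{a_r}yx^{a_{r-1}}y\cdots yx^{a_0}$ and $push(x^{a_0}y\cdots yx^{a_{r-1}}yx^{a_r})=x^{a_r}yx^{a_0}y\cdots yx^{a_{r-1}}$ ($a_i\ge0$). For a word $w$ containing $r$ letters $y$, $Push(w)$ is the list (with possible repetitions) of the $r+1$ words obtained from $w$ by iterating $push$. A polynomial $f$ homogeneous of degree $m$ is antipalindromic if $f=(-1)^m anti(f)$; push-invariant if $push(f)=f$; push-constant if $(f|y^m)=0$ and there is a constant $A$ with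 $\sum_{v\in Push(w)}(f|v)=A$ for all words $w\ne y^m$ of degree $m$. (Note that $F_y$ and $F_y-F_x$ have degree $n-1$.) The map $s$: $\partial_x$ is the derivation of $\mathbb{Q}\langle x,y\rangle$ with $\partial_x(x)=1$, $\partial_x(y)=0$, and $s(h)=\sum_{i\ge0}\frac{(-1)^i}{i!}\,\partial_x^i(h)\,y\,x^i$. Kashiwara-Vergne Lie algebra: $TR$ is the vector space quotient of $\mathbb{Q}\langle x,y\rangle$ by the relations $ab=ba$ (so the image of a monomial is its class under cyclic permutation of letters), and $tr:\mathbb{Q}\langle x,y\rangle\to TR$ is the quotient map. For $F,G\in\mathrm{Lie}_n[x,y]$ with $n\ge1$, $D_{F,G}$ is the derivation of $\mathrm{Lie}[x,y]$ with $x\mapsto[x,G]$, $y\mapsto[y,F]$; it is special if $[x,G]+[y,F]=0$. The underlying vector space of $\mathfrak{krv}_2$ is spanned by those special derivations $D_{F,G}$, with $F,G\in\mathrm{Lie}_n[x,y]$ and $n\ge1$, for which, writing $F=F_xx+F_yy$ and $G=G_xx+G_yy$, there is a constant $A$ such that $tr(F_yy+G_xx)=A\,tr\big((x+y)^n-x^n-y^n\big)$ in $TR$. It is a Lie algebra under the bracket of derivations, graded by the degree $n$.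
   Formalization: The isomorphism is onto the part of krv_2 of degree n ≥ 2: in degree 1 krv_2 also contains the nonzero special derivation D_{x,y}, which is not in the image of V_kv. It is also proved that krv_2 is the direct sum of the line spanned by D_{x,y} and that part. *)

(* Defs.v *)
From HB Require Import structures.
From mathcomp Require Import all_boot all_order all_algebra finmap.
From mathcomp Require Import boolp functions.
From mathcomp Require Import monalg.

Set Implicit Arguments.
Unset Strict Implicit.
Unset Printing Implicit Defensive.

Import GRing.Theory.
Local Open Scope ring_scope.

(* The letter x is [false], the letter y is [true]. *)
Definition letter := bool.
Definition lx : letter := false.
Definition ly : letter := true.

Definition word := seq letter.

Notation Qxy := {malg rat[{fmonom letter}]}.

Definition mon (w : word) : Qxy := << FMonom w >>.
Definition coef (f : Qxy) (w : word) : rat := f@_(FMonom w).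
Definition X : Qxy := mon [:: lx].
Definition Y : Qxy := mon [:: ly].

Definition linext (phi : word -> Qxy) (f : Qxy) : Qxy :=
  \sum_(m <- msupp f) f@_m *: phi m.

Definition homog (n : nat) (f : Qxy) : Prop :=
  forall w : word, coef f w != 0 -> size w = n.

(* F = rcof lx F * X + rcof ly F * Y = X * lcof lx F + Y * lcof ly F when F
   has no constant term: F_x, F_y are the [rcof]s and F^x, F^y the [lcof]s
   (lemmas rcofE and lcofE below). *)
Definition rcof (l : letter) : Qxy -> Qxy :=
  linext (fun w => if rev w is c :: w' then
                     if c == l then mon (rev w') else 0
                   else 0).
Definition lcof (l : letter) : Qxy -> Qxy :=
  linext (fun w => if w is c :: w' then
                     if c == l then mon w' else 0
                   else 0).

Lemma mulUmon a u v : << a *g FMonom u >> * mon v = << a *g FMonom (u ++ v) >>.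
Proof.
rewrite /mon malgM_def fgmulUU mulr1; congr << _ *g _ >>.
by apply/val_inj; rewrite /= fmM.
Qed.

Lemma monmulU a u v : mon u * << a *g FMonom v >> = << a *g FMonom (u ++ v) >>.
Proof.
rewrite /mon malgM_def fgmulUU mul1r; congr << _ *g _ >>.
by apply/val_inj; rewrite /= fmM.
Qed.

Lemma scale_mon a w : a *: mon w = << a *g FMonom w >>.
Proof. by apply/malgP=> k; rewrite mcoeffZ !mcoeffU mulr_natr. Qed.

Lemma rcofE F : coef F [::] = 0 -> F = rcof lx F * X + rcof ly F * Y.
Proof.
move=> F0; rewrite /rcof /linext !mulr_suml -big_split [LHS]monalgE /=.
apply: eq_bigr => -[w] _ /=; case/lastP: w => [|w l].
  by rewrite -/(coef F [::]) F0 monalgU0 !scale0r !mul0r addr0.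
rewrite rev_rcons revK -cats1.
by case: l => /=; rewrite scaler0 mul0r ?add0r ?addr0 scale_mon mulUmon.
Qed.

Lemma lcofE F : coef F [::] = 0 -> F = X * lcof lx F + Y * lcof ly F.
Proof.
move=> F0; rewrite /lcof /linext !mulr_sumr -big_split [LHS]monalgE /=.
apply: eq_bigr => -[[|l w]] _ /=.
  by rewrite -/(coef F [::]) F0 monalgU0 !scale0r !mulr0 addr0.
by case: l => /=; rewrite scaler0 mulr0 ?add0r ?addr0 scale_mon monmulU.
Qed.

(* x^a_0 y x^a_1 y ... y x^a_r is encoded by its list of exponents
   [:: a_0; a_1; ...; a_r], with a_i >= 0 and r the number of letters y. *)
Fixpoint word_exps (w : word) : seq nat :=
  match w with
  | [::] => [:: 0%N]
  | c :: w' => if c == ly then 0%N :: word_exps w'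
               else (head 0 (word_exps w')).+1 :: behead (word_exps w')
  end.
Definition exps_word (s : seq nat) : word :=
  nseq (head 0%N s) lx ++ flatten [seq ly :: nseq a lx | a <- behead s].

Definition anti_word (w : word) : word := exps_word (rev (word_exps w)).
Definition push_word (w : word) : word := exps_word (rotr 1 (word_exps w)).

Definition anti : Qxy -> Qxy := linext (fun w => mon (anti_word w)).
Definition push : Qxy -> Qxy := linext (fun w => mon (push_word w)).

Definition Push (w : word) : seq word :=
  traject push_word w (count_mem ly w).+1.

Definition antipalindromic (m : nat) (f : Qxy) : Prop :=
  f = (-1) ^+ m *: anti f.
Definition push_invariant (f : Qxy) : Prop := push f = f.
Definition push_constant (m : nat) (f : Qxy) : Prop :=
  coef f (nseq m ly) = 0 /\
  exists A : rat, forall w : word, size w = m -> w != nseq m ly ->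
    \sum_(v <- Push w) coef f v = A.

(* Leibniz: the sum over the occurrences of x of the word with that occurrence
   deleted. *)
Definition dx : Qxy -> Qxy :=
  linext (fun w => \sum_(i < size w | nth ly w i == lx)
                     mon (take i w ++ drop i.+1 w)).

(* The sum over i >= 0 stops at the degree of h, after which dx^i h = 0. *)
Definition s_map (h : Qxy) : Qxy :=
  \sum_(i < (\max_(m <- msupp h) size m).+1)
    ((-1) ^+ i / i`!%:R) *: (iter i dx h * Y * X ^+ i).

Section Span.
Variables (V : lmodType rat) (S : V -> Prop).

Definition span : {pred V} := fun v =>
  `[< exists (k : nat) (c : 'I_k -> rat) (u : 'I_k -> V),
        (forall i, S (u i)) /\ v = \sum_i c i *: u i >].

Lemma span_gen v : S v -> v \in span.
Proof.
move=> Sv; apply/asboolP; exists 1%N, (fun=> 1), (fun=> v); split=> //.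
by rewrite big_ord1 scale1r.
Qed.

Lemma span_submod : submod_closed span.
Proof.
split; first by apply/asboolP; exists 0%N, (fun=> 0), (fun=> 0);
  split=> [[] //|]; rewrite big_ord0.
move=> a u v /asboolP[k [c [f [Sf ->]]]] /asboolP[k' [c' [f' [Sf' ->]]]].
apply/asboolP; exists (k + k')%N.
exists (fun i => match fintype.split i with inl j => a * c j | inr j => c' j end).
exists (fun i => match fintype.split i with inl j => f j | inr j => f' j end).
split; first by move=> i; case: fintype.split.
rewrite big_split_ord /= scaler_sumr; congr (_ + _); apply: eq_bigr => i _.
  by rewrite (unsplitK (inl i)) scalerA.
by rewrite (unsplitK (inr i)).
Qed.

HB.instance Definition _ := GRing.isSubmodClosed.Build rat V span span_submod.

Record spanT : Type := SpanT { spanT_val :> V; _ : spanT_val \in span }.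

HB.instance Definition _ := [isSub for spanT_val].
HB.instance Definition _ := [Choice of spanT by <:].
HB.instance Definition _ := [SubChoice_isSubLmodule of spanT by <:].
End Span.

Definition br (f g : Qxy) : Qxy := f * g - g * f.

Inductive lie_poly : Qxy -> Prop :=
| lie_X : lie_poly X
| lie_Y : lie_poly Y
| lie_lin (a : rat) f g : lie_poly f -> lie_poly g -> lie_poly (a *: f + g)
| lie_br f g : lie_poly f -> lie_poly g -> lie_poly (br f g).

Definition lie_pred : {pred Qxy} := fun f => `[< lie_poly f >].

Lemma lie_submod : submod_closed lie_pred.
Proof.
split=> [|a f g /asboolP Lf /asboolP Lg]; apply/asboolP; last exact: lie_lin.
by rewrite -(addNr X) -scaleN1r; apply: lie_lin; apply: lie_X.
Qed.

HB.instance Definition _ := GRing.isSubmodClosed.Build rat Qxy lie_pred lie_submod.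

Record Lie : Type := MkLie { lie_val :> Qxy; _ : lie_val \in lie_pred }.

HB.instance Definition _ := [isSub for lie_val].
HB.instance Definition _ := [Choice of Lie by <:].
HB.instance Definition _ := [SubChoice_isSubLmodule of Lie by <:].

Lemma lieP (F : Lie) : lie_poly F.
Proof. by case: F => f /= /asboolP. Qed.

Definition LX : Lie := MkLie (asboolT lie_X).
Definition LY : Lie := MkLie (asboolT lie_Y).
Definition Lbr (F G : Lie) : Lie := MkLie (asboolT (lie_br (lieP F) (lieP G))).

Definition lie_derivation (D : Lie -> Lie) : Prop :=
  linear D /\ forall F G, D (Lbr F G) = Lbr (D F) G + Lbr F (D G).

(* D = D_{F,G}; a derivation of Lie[x,y] is determined by its values on x
   and y. *)
Definition is_Der (F G : Lie) (D : Lie -> Lie) : Prop :=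
  [/\ lie_derivation D, D LX = Lbr LX G & D LY = Lbr LY F].

Definition special (F G : Lie) : Prop := Lbr LX G + Lbr LY F = 0.

Definition commutator (f : Qxy) : Prop := exists a b, f = a * b - b * a.

Definition TR := Quotient.quot (span commutator).
HB.instance Definition _ := GRing.Zmodule.on TR.

Definition tr (f : Qxy) : TR := (\pi_TR f)%qT.

Definition TR_scale (a : rat) (t : TR) : TR := tr (a *: repr t).

Lemma trP f g : (tr f == tr g) = (f - g \in span commutator).
Proof. by rewrite Quotient.idealrBE. Qed.

Lemma TR_scale_tr a f : TR_scale a (tr f) = tr (a *: f).
Proof.
apply/eqP; rewrite trP -scalerBr rpredZ // -trP /tr.
by rewrite reprK.
Qed.

Lemma tr_is_additive : zmod_morphism tr.
Proof. by move=> f g; rewrite /tr raddfB. Qed.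

HB.instance Definition _ := GRing.isZmodMorphism.Build Qxy TR tr tr_is_additive.

Lemma tr_surj t : exists f, t = tr f.
Proof. by exists (repr t); rewrite /tr reprK. Qed.

Lemma TR_scalerA a b t : TR_scale a (TR_scale b t) = TR_scale (a * b) t.
Proof. by have [f ->] := tr_surj t; rewrite !TR_scale_tr scalerA. Qed.

Lemma TR_scale1r : left_id 1 TR_scale.
Proof. by move=> t; have [f ->] := tr_surj t; rewrite TR_scale_tr scale1r. Qed.

Lemma TR_scalerDr : right_distributive TR_scale +%R.
Proof.
move=> a t u; have [[f ->] [g ->]] := (tr_surj t, tr_surj u).
by rewrite -raddfD !TR_scale_tr scalerDr raddfD.
Qed.

Lemma TR_scalerDl t : {morph TR_scale^~ t : a b / a + b}.
Proof.
move=> a b; have [f ->] := tr_surj t.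
by rewrite !TR_scale_tr scalerDl raddfD.
Qed.

HB.instance Definition _ := GRing.Zmodule_isLmodule.Build rat TR
  TR_scalerA TR_scale1r TR_scalerDr TR_scalerDl.

Definition kv_gen (n : nat) (F : Lie) : Prop :=
  [/\ homog n F,
      antipalindromic n.-1 (rcof ly F) &
      push_constant n.-1 (rcof ly F - rcof lx F)].

Definition Vkv : lmodType rat :=
  spanT (fun F : Lie => exists2 n, (3 <= n)%N & kv_gen n F).

Definition krv2_gen (n : nat) (D : Lie -> Lie) : Prop :=
  exists F G : Lie,
    [/\ homog n F, homog n G, is_Der F G D, special F G &
        exists A : rat, tr (rcof ly F * Y + rcof lx G * X)
                        = A *: tr ((X + Y) ^+ n - X ^+ n - Y ^+ n)].

(* The part of degree at least d; krv2 itself has degrees n >= 1. Its degree 1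
   part is the line spanned by D_{x,y} : x |-> [x,y], y |-> [y,x], which is
   special and satisfies the trace condition 0 = A *: 0; its degree 2 part
   is 0. *)
Definition krv2_from (d : nat) : lmodType rat :=
  spanT (fun D : Lie -> Lie => exists2 n, (d <= n)%N & krv2_gen n D).

Definition krv2 : lmodType rat := krv2_from 1.

(* Main.v *)
(* If [x, G] + [y, F] = 0, then H = xG + yF = Gx + Fy has coefficients invariant
   under cyclic permutation of words.  Reading F and G off H gives F_y = F^y
   (which for a Lie polynomial is antipalindromicity of F_y), push-invariance
   of F, and G_y = F^x.  A polynomial killed by d_x is determined by its
   right y-part, so G = s(F^x).
   Conversely, if F_y = F^y and G = s(F^x), then [x, G] + [y, F] is killed by
   d_x and has zero right y-part, hence vanishes; G is a Lie polynomial because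
   [x, G] = - [y, F] is one, by the Dynkin-Specht-Wever operator.
   For the trace condition, two homogeneous polynomials have the same trace iff
   their coefficients have the same sums over rotations of each word.  The
   rotations of w'y summed over F_y y + G_x x differ from the sum of F_y - F_x
   over Push(w') by the coefficient of w' in d_x F, which is 0. *)

Require Import Defs.
From HB Require Import structures.
From mathcomp Require Import all_boot all_order all_algebra finmap.
From mathcomp Require Import boolp functions.
From mathcomp Require Import monalg.

Set Implicit Arguments.
Unset Strict Implicit.
Unset Printing Implicit Defensive.

Import GRing.Theory.
Local Open Scope ring_scope.

(** * Coefficients and linear extension *)

(** The space V_kv starts in degree 3, so the line of D_{x,y} in degree 1 cannot be in the image.
    The map is therefore shown bijective onto [krv2_from 2], and the last clause of the theorem
    splits [krv2] into that space and the line. Degree 2 causes no trouble: a special F has equal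
    coefficients at xy and yx, while a Lie polynomial has opposite ones.

    Extending F -> D_{F,G} from generators to their span raises no question of well-definedness,
    because G = s(F^x) is linear in F and the derivation is linear in (F, G): one formula, [kvDer],
    makes sense for every polynomial.

    Injectivity reads F off D(y) = [y,F]. The kernel of [y, .] consists of polynomials in y alone,
    and elements of V_kv have no pure powers. The same centralizer argument, with x for y, underlies
    the proof that G is Lie.

    In characteristic 0, averaging over rotations shows that the rotation sums separate the points
    of TR in each positive degree. A push-constant A corresponds to the trace constant A / n, since
    a word of length n has n rotations. *)

Lemma coef_ext (f g : Qxy) : (forall w, coef f w = coef g w) -> f = g.
Proof. by move=> fg; apply/malgP => -[w]; apply: fg. Qed.

Lemma coef0 w : coef 0 w = 0. Proof. exact: mcoeff0. Qed.
Lemma coefD f g w : coef (f + g) w = coef f w + coef g w.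
Proof. exact: mcoeffD. Qed.
Lemma coefN f w : coef (- f) w = - coef f w.
Proof. exact: mcoeffN. Qed.
Lemma coefB f g w : coef (f - g) w = coef f w - coef g w.
Proof. exact: mcoeffB. Qed.
Lemma coefZ a f w : coef (a *: f) w = a * coef f w.
Proof. exact: mcoeffZ. Qed.
Lemma coefP a f g w : coef (a *: f + g) w = a * coef f w + coef g w.
Proof. by rewrite coefD coefZ. Qed.
Lemma coef_sum (I : Type) (r : seq I) (P : pred I) (E : I -> Qxy) w :
  coef (\sum_(i <- r | P i) E i) w = \sum_(i <- r | P i) coef (E i) w.
Proof. exact: (raddf_sum (mcoeff (FMonom w))). Qed.

Lemma coef_mon u w : coef (mon u) w = (u == w)%:R.
Proof. by rewrite /coef /mon mcoeffU1. Qed.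

(** Words outside the support contribute 0, so the support may be enlarged; linearity then follows
    by summing over a set common to all the polynomials involved. *)
Lemma linextEw (phi : word -> Qxy) (d : {fset {fmonom letter}}) (f : Qxy) :
  (msupp f `<=` d)%fset -> linext phi f = \sum_(m <- d) f@_m *: phi m.
Proof.
move=> fd; rewrite /linext (big_fset_incl _ fd) // => m _ mf.
by rewrite mcoeff_outdom // scale0r.
Qed.

Lemma linext_linear (phi : word -> Qxy) : linear (linext phi).
Proof.
move=> a f g; pose d := (msupp (a *: f + g) `|` msupp f `|` msupp g)%fset.
rewrite !(@linextEw _ d); first last.
- by apply/fsubsetP=> k kf; rewrite /d !in_fsetU kf.
- by apply/fsubsetP=> k kf; rewrite /d !in_fsetU kf orbT.
- by apply/fsubsetP=> k kf; rewrite /d !in_fsetU kf orbT.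
rewrite scaler_sumr -big_split; apply: eq_bigr => m _ /=.
by rewrite mcoeffD mcoeffZ scalerDl scalerA.
Qed.

Lemma linext_mon phi w : linext phi (mon w) = phi w.
Proof. by rewrite /linext msuppU1 big_seq_fset1 mcoeffUU scale1r. Qed.

Lemma mon_ind (P : Qxy -> Prop) :
  P 0 -> (forall a w f, P f -> P (a *: mon w + f)) -> forall f, P f.
Proof.
move=> P0 PD f; rewrite [f]monalgE; elim: (X in \sum_(k <- X) _) => [|[w] r IH].
  by rewrite big_nil.
by rewrite big_cons -scale_mon; apply: PD.
Qed.

Lemma linear_mon_ext (V : lmodType rat) (p q : Qxy -> V) :
  linear p -> linear q -> (forall w, p (mon w) = q (mon w)) -> p =1 q.
Proof.
have lin0 (h : Qxy -> V) : linear h -> h 0 = 0.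
  by move=> /(_ (-1) 0 0); rewrite scaler0 addr0 scaleN1r addNr.
move=> pl ql pq; apply: mon_ind => [|a w f IH]; first by rewrite !lin0.
by rewrite pl ql pq IH.
Qed.

Lemma scalar_mon_ext (p q : Qxy -> rat) :
  scalar p -> scalar q -> (forall w, p (mon w) = q (mon w)) -> p =1 q.
Proof. exact: (@linear_mon_ext rat^o). Qed.

(** Scalars are central because [rat] is commutative. The lemmas below over an abstract [lalgType]
    take this as a hypothesis, since there scalars only slide out of the left factor. *)
Lemma mulZr (a : rat) (f g : Qxy) : f * (a *: g) = a *: (f * g).
Proof.
apply/malgP => k; rewrite mcoeffZ [LHS](@mcoeffMrw _ _ (msupp f) (msupp g)) //.
  rewrite (mcoeffMr f g) mulr_sumr; apply: eq_bigr => k1 _.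
  rewrite mulr_sumr; apply: eq_bigr => k2 _.
  by rewrite mcoeffZ mulrnAr mulrCA.
exact: msuppZ_le.
Qed.

Lemma monM u v : mon u * mon v = mon (u ++ v).
Proof. exact: mulUmon. Qed.

Lemma mon_nil : mon [::] = 1.
Proof. by rewrite /mon -fmoneE. Qed.

Lemma bilinear_mon_ext (V : lmodType rat) (p q : Qxy -> Qxy -> V) :
  (forall g, linear (p^~ g)) -> (forall f, linear (p f)) ->
  (forall g, linear (q^~ g)) -> (forall f, linear (q f)) ->
  (forall u v, p (mon u) (mon v) = q (mon u) (mon v)) ->
  forall f g, p f g = q f g.
Proof.
move=> pl pr ql qr pq f g; apply: (linear_mon_ext (pl g) (ql g)) => u.
exact: (linear_mon_ext (pr (mon u)) (qr (mon u))).
Qed.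

Lemma mul_linearl (g : Qxy) : linear (fun f : Qxy => f * g).
Proof. by move=> a f h; rewrite mulrDl scalerAl. Qed.
Lemma mul_linearr (f : Qxy) : linear (fun g : Qxy => f * g).
Proof. by move=> a g h; rewrite mulrDr mulZr. Qed.

Lemma coef_rcof l F w : coef (rcof l F) w = coef F (rcons w l).
Proof.
apply: (@scalar_mon_ext (fun F => coef (rcof l F) w) (fun F => coef F (rcons w l))).
- by move=> a f g; rewrite /rcof linext_linear coefP.
- by move=> a f g; rewrite coefP.
move=> u; rewrite /rcof linext_mon coef_mon.
case/lastP: u => [|u c]; first by rewrite coef0; case: (w).
rewrite rev_rcons revK eqseq_rcons.
by case: (c == l); rewrite ?coef_mon ?coef0 ?andbT ?andbF.
Qed.

Lemma coef_lcof l F w : coef (lcof l F) w = coef F (l :: w).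
Proof.
apply: (@scalar_mon_ext (fun F => coef (lcof l F) w) (fun F => coef F (l :: w))).
- by move=> a f g; rewrite /lcof linext_linear coefP.
- by move=> a f g; rewrite coefP.
move=> u; rewrite /lcof linext_mon coef_mon.
case: u => [|c u]; first by rewrite coef0.
by rewrite eqseq_cons; case: (c == l); rewrite ?coef_mon ?coef0.
Qed.

Lemma rcof_linear l : linear (rcof l). Proof. exact: linext_linear. Qed.
Lemma lcof_linear l : linear (lcof l). Proof. exact: linext_linear. Qed.

Lemma coef_mulr_letter f c u l :
  coef (f * mon [:: c]) (rcons u l) = if l == c then coef f u else 0.
Proof.
apply: (@scalar_mon_ext (fun f => coef (f * mon [:: c]) (rcons u l))
                        (fun f => if l == c then coef f u else 0)).
- by move=> a g h; rewrite mul_linearl coefP.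
- by move=> a g h; rewrite coefP; case: ifP => // _; rewrite mulr0 addr0.
move=> v; rewrite monM cats1 coef_mon eqseq_rcons (eq_sym c) coef_mon.
by case: (l == c); rewrite ?andbT ?andbF.
Qed.

Lemma coef_mulr_letter0 f c : coef (f * mon [:: c]) [::] = 0.
Proof.
apply: (@scalar_mon_ext (fun f => coef (f * mon [:: c]) [::]) (fun=> 0)).
- by move=> a g h; rewrite mul_linearl coefP.
- by move=> a g h; rewrite mulr0 addr0.
by move=> v; rewrite monM cats1 coef_mon; case: v.
Qed.

Lemma coef_mull_letter f c l u :
  coef (mon [:: c] * f) (l :: u) = if l == c then coef f u else 0.
Proof.
apply: (@scalar_mon_ext (fun f => coef (mon [:: c] * f) (l :: u))
                        (fun f => if l == c then coef f u else 0)).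
- by move=> a g h; rewrite mul_linearr coefP.
- by move=> a g h; rewrite coefP; case: ifP => // _; rewrite mulr0 addr0.
move=> v; rewrite monM /= coef_mon eqseq_cons (eq_sym c) coef_mon.
by case: (l == c).
Qed.

Lemma coef_mull_letter0 f c : coef (mon [:: c] * f) [::] = 0.
Proof.
apply: (@scalar_mon_ext (fun f => coef (mon [:: c] * f) [::]) (fun=> 0)).
- by move=> a g h; rewrite mul_linearr coefP.
- by move=> a g h; rewrite mulr0 addr0.
by move=> v; rewrite monM coef_mon.
Qed.

Lemma homog_lin n a f g : homog n f -> homog n g -> homog n (a *: f + g).
Proof.
move=> fn gn w; rewrite coefP.
have [->|/fn //] := eqVneq (coef f w) 0.
by rewrite mulr0 add0r => /gn.
Qed.

Lemma homog_coef n f w : homog n f -> size w != n -> coef f w = 0.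
Proof. by move=> fn /eqP wn; apply/eqP/negPn/negP => /fn. Qed.

Lemma homog_ext n f g : homog n f -> homog n g ->
  (forall w, size w = n -> coef f w = coef g w) -> f = g.
Proof.
move=> fn gn fg; apply: coef_ext => w; have [/fg //|wn] := eqVneq (size w) n.
by rewrite (homog_coef fn wn) (homog_coef gn wn).
Qed.

Lemma homog_mull n c f : homog n f -> homog n.+1 (mon [:: c] * f).
Proof.
move=> fn [|l w]; first by rewrite coef_mull_letter0 eqxx.
by rewrite coef_mull_letter /=; case: (l =P c) => [_ /fn <- //|_]; rewrite eqxx.
Qed.

Lemma homog_mulr n c f : homog n f -> homog n.+1 (f * mon [:: c]).
Proof.
move=> fn w; case/lastP: w => [|w l]; first by rewrite coef_mulr_letter0 eqxx.
rewrite coef_mulr_letter size_rcons.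
by case: (l =P c) => [_ /fn -> //|_]; rewrite eqxx.
Qed.

Lemma homog0 n : homog n 0.
Proof. by move=> w; rewrite coef0 eqxx. Qed.

(** The free algebra has one derivation for each choice of values on the letters. This construction
    serves for [dx], for the Euler operator and for D_{F,G}. *)
Fixpoint der_word (v : letter -> Qxy) (w : word) : Qxy :=
  if w is c :: w' then v c * mon w' + mon [:: c] * der_word v w' else 0.
Definition der (v : letter -> Qxy) : Qxy -> Qxy := linext (der_word v).

Lemma der_linear v : linear (der v). Proof. exact: linext_linear. Qed.
Lemma dx_linear : linear dx. Proof. exact: linext_linear. Qed.

(** * Derivations and the map s *)

Lemma linear_fun0 (V : lmodType rat) (p : Qxy -> V) : linear p -> p 0 = 0.
Proof. by move=> /(_ (-1) 0 0); rewrite scaler0 addr0 scaleN1r addNr. Qed.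

Lemma linear_funZ (V : lmodType rat) (p : Qxy -> V) a f :
  linear p -> p (a *: f) = a *: p f.
Proof. by move=> pl; have := pl a f 0; rewrite (linear_fun0 pl) !addr0. Qed.

Lemma linear_funD (V : lmodType rat) (p : Qxy -> V) f g :
  linear p -> p (f + g) = p f + p g.
Proof. by move=> pl; have := pl 1 f g; rewrite !scale1r. Qed.

Lemma linear_funB (V : lmodType rat) (p : Qxy -> V) f g :
  linear p -> p (f - g) = p f - p g.
Proof. by move=> pl; have := pl (-1) g f; rewrite !scaleN1r ![- _ + _]addrC. Qed.

Lemma ring_derM (R : pzRingType) (a b x d e f : R) :
  a * (b * e) + x * (d * e + b * f) = (a * b + x * d) * e + (x * b) * f.
Proof. by rewrite mulrDl mulrDr !mulrA addrA. Qed.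

Lemma der_word_cat v u w :
  der_word v (u ++ w) = der_word v u * mon w + mon u * der_word v w.
Proof.
elim: u => [|c u IH] /=; first by rewrite mul0r add0r mon_nil mul1r.
rewrite IH -(monM u w) -(monM [:: c] u); exact: ring_derM.
Qed.

Lemma derM v f g : der v (f * g) = der v f * g + f * der v g.
Proof.
apply: (@bilinear_mon_ext _ (fun f g => der v (f * g))
                            (fun f g => der v f * g + f * der v g)).
- by move=> {}g a h k; rewrite mul_linearl der_linear.
- by move=> {}f a h k; rewrite mul_linearr der_linear.
- move=> {}g a h k; rewrite der_linear !mul_linearl scalerDr.
  by rewrite addrACA.
- move=> {}f a h k; rewrite der_linear !mul_linearr scalerDr.
  by rewrite addrACA.
by move=> u w; rewrite monM /der !linext_mon der_word_cat.
Qed.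

Lemma der_mon1 v c : der v (mon [:: c]) = v c.
Proof. by rewrite /der linext_mon /= mulr0 addr0 mon_nil mulr1. Qed.

Lemma der_one v : der v 1 = 0.
Proof. by rewrite -mon_nil /der linext_mon. Qed.

Lemma ring_derB (R : pzRingType) (d : R -> R) :
  {morph d : a b / a - b} -> (forall a b, d (a * b) = d a * b + a * d b) ->
  forall a b, d (a * b - b * a) = (d a * b - b * d a) + (a * d b - d b * a).
Proof.
move=> dB dM a b; rewrite dB !dM [d b * a + _]addrC opprD addrACA.
by [].
Qed.

Lemma derB v : {morph der v : f g / f - g}.
Proof. move=> f g; exact: (linear_funB f g (der_linear v)). Qed.

Lemma der_br v f g : der v (br f g) = br (der v f) g + br f (der v g).
Proof. exact: (ring_derB (derB v) (derM v)). Qed.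

Lemma dxE : dx =1 der (fun c => (c == lx)%:R).
Proof.
apply: linear_mon_ext; [exact: dx_linear|exact: der_linear|].
move=> w; rewrite /dx /der !linext_mon.
elim: w => [|c w IH] /=; first by rewrite big_ord0.
rewrite big_mkcond big_ord_recl /= drop0; congr (_ + _).
  by case: (c == lx); rewrite ?mul1r ?mul0r.
rewrite -IH mulr_sumr [RHS]big_mkcond /=; apply: eq_bigr => i _.
by rewrite /bump /=; case: ifP; rewrite // monM.
Qed.

Lemma dxM f g : dx (f * g) = dx f * g + f * dx g.
Proof. by rewrite !dxE derM. Qed.
Lemma dx_X : dx X = 1. Proof. by rewrite dxE der_mon1. Qed.
Lemma dx_Y : dx Y = 0. Proof. by rewrite dxE der_mon1. Qed.
Lemma dx_br f g : dx (br f g) = br (dx f) g + br f (dx g).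
Proof. by rewrite !dxE der_br. Qed.
Lemma dx_one : dx 1 = 0. Proof. by rewrite dxE der_one. Qed.
Lemma dx0 : dx 0 = 0. Proof. exact: (linear_fun0 dx_linear). Qed.
Lemma dxZ a f : dx (a *: f) = a *: dx f. Proof. exact: (linear_funZ _ _ dx_linear). Qed.
Lemma dxD f g : dx (f + g) = dx f + dx g. Proof. exact: (linear_funD _ _ dx_linear). Qed.
Lemma dxB f g : dx (f - g) = dx f - dx g. Proof. exact: (linear_funB _ _ dx_linear). Qed.

(** Transpose of deletion: the words that yield w by losing an x are those with an x inserted in one
    of the [(size w).+1] gaps, counted with multiplicity. *)
Lemma coef_dx f w :
  coef (dx f) w = \sum_(i < (size w).+1) coef f (take i w ++ lx :: drop i w).
Proof.
apply: (@scalar_mon_ext (fun f => coef (dx f) w)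
  (fun f => \sum_(i < (size w).+1) coef f (take i w ++ lx :: drop i w))).
- by move=> a g h; rewrite dx_linear coefP.
- move=> a g h; rewrite mulr_sumr -big_split; apply: eq_bigr => i _.
  exact: coefP.
move=> u; rewrite dxE /der linext_mon.
elim: u w => [|c u IH] [|l w] /=.
- by rewrite big_ord1 coef0 coef_mon.
- by rewrite coef0 big1 // => i _; rewrite coef_mon; case: (take _ _).
- rewrite big_ord1 /= (coef_mon (c :: u)) eqseq_cons.
  apply: etrans (coefD _ _ _) _.
  apply: etrans (congr1 _ (coef_mull_letter0 _ _)) _; rewrite addr0.
  by case: (c == lx); rewrite ?mul1r ?mul0r ?coef0 ?coef_mon.
apply: etrans (coefD _ _ _) _.
apply: etrans (congr1 _ (coef_mull_letter _ _ _ _)) _.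
rewrite IH [in RHS]big_ord_recl /= (coef_mon (c :: u) (lx :: l :: w)) eqseq_cons.
congr (_ + _); first by case: (c == lx); rewrite ?mul1r ?mul0r ?coef0 ?coef_mon.
rewrite [l == c]eq_sym; case: eqP => [<-|/eqP cl]; last first.
  by rewrite big1 // => i _; rewrite coef_mon /= eqseq_cons (negPf cl).
by apply: eq_bigr => i _; rewrite !coef_mon /= eqseq_cons eqxx.
Qed.

Lemma dx_iter_eq0 d h : (forall w, (d <= size w)%N -> coef h w = 0) -> iter d dx h = 0.
Proof.
elim: d h => [|d IH] h hd; first by apply: coef_ext => w; rewrite coef0 hd.
rewrite iterSr IH // => w dw; rewrite coef_dx big1 // => i _.
by rewrite hd // size_cat /= addnS -size_cat cat_take_drop.
Qed.

Lemma dx_expX k : dx (X ^+ k) = k%:R *: X ^+ k.-1.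
Proof.
elim: k => [|k IH]; first by rewrite expr0 dx_one scale0r.
rewrite exprS dxM dx_X mul1r IH mulZr /=.
case: k {IH} => [|k]; first by rewrite scale0r addr0 scale1r.
by rewrite -exprS -[X in X + _]scale1r -scalerDl -(natrD _ 1).
Qed.

Lemma ring_der_term (A : lalgType rat) (d : A -> A) (x y h : A) i :
  (forall a b, d (a * b) = d a * b + a * d b) -> d y = 0 ->
  d (x ^+ i) = i%:R *: x ^+ i.-1 ->
  (forall (a : rat) (u v : A), u * (a *: v) = a *: (u * v)) ->
  d (h * y * x ^+ i) = d h * y * x ^+ i + i%:R *: (h * y * x ^+ i.-1).
Proof. by move=> dM dy dxi Zr; rewrite !dM dy dxi Zr mulr0 addr0. Qed.

Lemma sum_telescope (V : zmodType) (U : nat -> V) k :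
  \sum_(i < k.+1) (U i - (if val i is j.+1 then U j else 0)) = U k.
Proof.
elim: k => [|k IH]; first by rewrite big_ord1 /= subr0.
by rewrite big_ord_recr /= IH addrCA subrr addr0.
Qed.

Lemma sign_fact_rec i :
  ((-1) ^+ i.+1 / i.+1`!%:R) * i.+1%:R = - ((-1) ^+ i / i`!%:R) :> rat.
Proof.
rewrite factS natrM exprS mulN1r invfM !mulNr -mulrA; congr (- (_ * _)).
by rewrite mulrAC mulVf ?mul1r // Num.Theory.pnatr_eq0.
Qed.

Lemma msupp_size_bound (h : Qxy) (w : word) :
  (\max_(m <- msupp h) size m < size w)%N -> coef h w = 0.
Proof.
move=> dw; apply/eqP; apply: contraTT dw; rewrite -leqNgt mcoeff_neq0 => hw.
exact: (@leq_bigmax_seq _ _ xpredT (fun m : fmonom letter => size m) (FMonom w)).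
Qed.

(** Differentiating the i-th term gives [U i - U i.-1] (with no second part at i = 0), so the sum
    telescopes to the top term, which contains the derivative of h of order larger than its
    degree. *)
Lemma dx_smap h : dx (s_map h) = 0.
Proof.
rewrite /s_map; set d := \max_(m <- msupp h) size m.
pose U i := ((-1) ^+ i / i`!%:R) *: (iter i.+1 dx h * Y * X ^+ i).
have term i : dx (((-1) ^+ i / i`!%:R) *: (iter i dx h * Y * X ^+ i)) =
    U i - (if i is j.+1 then U j else 0).
  rewrite dxZ (@ring_der_term _ dx X Y (iter i dx h) i dxM dx_Y (dx_expX i) mulZr).
  rewrite scalerDr scalerA; congr (_ + _); case: i => [|i].
    by rewrite mulr0 scale0r oppr0.
  by rewrite sign_fact_rec scaleNr.
have dx_sum (r : seq 'I_d.+1) (E : 'I_d.+1 -> Qxy) :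
    dx (\sum_(i <- r) E i) = \sum_(i <- r) dx (E i).
  by apply: (big_morph _ dxD dx0).
rewrite dx_sum (eq_bigr _ (fun (i : 'I_d.+1) _ => term i)) sum_telescope /U.
rewrite (@dx_iter_eq0 d.+1 h) ?mul0r ?scaler0 // => w dw.
exact: msupp_size_bound.
Qed.

Lemma coef_smap_term h i w :
  coef (((-1) ^+ i.+1 / i.+1`!%:R) *: (iter i.+1 dx h * Y * X ^+ i.+1)) (rcons w ly)
  = 0.
Proof. by rewrite coefZ (exprSr X) (mulrA (_ * Y)) coef_mulr_letter mulr0. Qed.

Lemma smap_term0 h :
  ((-1) ^+ 0 / 0`!%:R) *: (iter 0 dx h * Y * X ^+ 0) = h * Y :> Qxy.
Proof. by rewrite !expr0 fact0 divr1 scale1r mulr1. Qed.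

(** All terms with i > 0 end in x; only the term h y at i = 0 is seen. *)
Lemma rcofy_smap h : rcof ly (s_map h) = h.
Proof.
apply: coef_ext => w; rewrite coef_rcof /s_map coef_sum big_ord_recl.
rewrite [X in _ + X]big1 => [|i _]; last by rewrite lift0; apply: coef_smap_term.
by rewrite smap_term0 coef_mulr_letter addr0.
Qed.

Lemma coef0_smap h : coef (s_map h) [::] = 0.
Proof.
rewrite /s_map coef_sum big1 // => i _; case: (nat_of_ord i) => [|k].
  by rewrite smap_term0 coef_mulr_letter0.
by rewrite coefZ (exprSr X) (mulrA (_ * Y)) coef_mulr_letter0 mulr0.
Qed.

(* With [f = g x], the relation [d f = 0] reads [g = - d g x], and applying
   [d] repeatedly gives [(i + 1) d^i g = - d^(i+1) g x]; then descend from a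
   large [i] with [d^i g = 0]. *)
Lemma ring_der_nilp (A : lalgType rat) (d : A -> A) (x g : A) n :
  linear d -> (forall a b, d (a * b) = d a * b + a * d b) -> d x = 1 ->
  d (g * x) = 0 -> iter n d g = 0 -> g = 0.
Proof.
move=> dl dM dx1 dgx.
have d0 : d 0 = 0 by have := dl (-1) 0 0; rewrite scaler0 addr0 scaleN1r addNr.
have dZ c a : d (c *: a) = c *: d a by have := dl c a 0; rewrite d0 !addr0.
have rel i : i.+1%:R *: iter i d g = - (iter i.+1 d g * x).
  elim: i => [|i IH] /=.
    by apply/eqP; rewrite scale1r -addr_eq0 addrC -{2}[g]mulr1 -dx1 -dM dgx.
  have := congr1 d IH; rewrite dZ -scaleN1r dZ scaleN1r dM dx1 mulr1 /= => /eqP.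
  rewrite opprD -subr_eq opprK -[X in _ + X]scale1r -scalerDl natr1.
  by move/eqP.
elim: n => [//|i IH di]; apply: IH; have := rel i.
rewrite di mul0r oppr0 => /eqP; rewrite scaler_eq0 Num.Theory.pnatr_eq0 /=.
by move/eqP.
Qed.

(** The hypotheses leave f = g x with zero derivative, and iterated derivatives of g vanish beyond
    its degree. The constant term must be excluded separately: [dx] kills it and [rcof] does not see
    it. *)
Lemma dx_rcofy_eq0 f :
  dx f = 0 -> rcof ly f = 0 -> coef f [::] = 0 -> f = 0.
Proof.
move=> df fy f0; have := rcofE f0; rewrite fy mul0r addr0 => fE.
suff fx : rcof lx f = 0 by rewrite fE fx mul0r.
have dgx : dx (rcof lx f * X) = 0 by rewrite -fE.
apply: (ring_der_nilp (n := (\max_(m <- msupp (rcof lx f)) size m).+1)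
  dx_linear dxM dx_X dgx).
by apply: dx_iter_eq0 => w dw; apply: msupp_size_bound.
Qed.

Lemma smap_unique f h :
  dx f = 0 -> rcof ly f = h -> coef f [::] = 0 -> f = s_map h.
Proof.
move=> df fy f0; apply/eqP; rewrite -subr_eq0; apply/eqP; apply: dx_rcofy_eq0.
- by rewrite dxB df dx_smap subrr.
- by rewrite (linear_funB _ _ (rcof_linear ly)) fy rcofy_smap subrr.
- by rewrite coefB f0 coef0_smap subrr.
Qed.

(** The number of summands of [s_map] depends on its argument, so linearity is not termwise; it
    follows from the characterization of [s_map] by its derivative and its right y-part. *)
Lemma smap_linear : linear s_map.
Proof.
move=> a g h; symmetry; apply: smap_unique.
- by rewrite dx_linear !dx_smap scaler0 addr0.
- by rewrite rcof_linear !rcofy_smap.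
- by rewrite coefP !coef0_smap mulr0 addr0.
Qed.

(** * Lie polynomials *)

Lemma ring_br_linear (A : lalgType rat) (a : rat) (f h g : A) :
  (forall (a : rat) (u v : A), u * (a *: v) = a *: (u * v)) ->
  (a *: f + h) * g - g * (a *: f + h) = a *: (f * g - g * f) + (h * g - g * h).
Proof.
by move=> Zr; rewrite mulrDl mulrDr Zr -scalerAl opprD addrACA scalerBr.
Qed.

Lemma ring_brN (R : pzRingType) (f g : R) : f * g - g * f = - (g * f - f * g).
Proof. by rewrite opprB. Qed.

Lemma lmod_lin_swap (V : lmodType rat) (a b : rat) (p q r s : V) :
  b *: (a *: p + q) + (a *: r + s) = a *: (b *: p + r) + (b *: q + s).
Proof. by rewrite !scalerDr !scalerA mulrC addrACA. Qed.

Lemma lmod_linD (V : lmodType rat) (a b c : rat) (p q r : V) :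
  (a *: p + q) + (a * b + c) *: r = a *: (p + b *: r) + (q + c *: r).
Proof. by rewrite scalerDl scalerDr scalerA addrACA. Qed.

Lemma lmod_linDr (V : lmodType rat) (a b : rat) (p q r s : V) :
  (a *: p + q) + b *: (a *: r + s) = a *: (p + b *: r) + (q + b *: s).
Proof. by rewrite !scalerDr !scalerA mulrC addrACA. Qed.

Lemma ring_brNN (R : pzRingType) (f g : R) :
  (- g) * (- f) - (- f) * (- g) = - (f * g - g * f).
Proof. by rewrite !mulrNN opprB. Qed.

Lemma ring_jacobi (R : pzRingType) (p q f : R) :
  (p * (q * f - f * q) - (q * f - f * q) * p)
    - (q * (p * f - f * p) - (p * f - f * p) * q)
  = (p * q - q * p) * f - f * (p * q - q * p).
Proof.
have zmod_jacobi (V : zmodType) (a b c d e k : V) :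
    (a - b) - (c - d) - ((e - c) - (b - k)) = (a - e) - (k - d).
  by rewrite !opprB addrACA !addrA !subrK addrAC (addrAC a) addrAC.
rewrite !mulrBr !mulrBl !mulrA; exact: zmod_jacobi.
Qed.

Lemma ring_brbr (R : pzRingType) (x g : R) :
  (x * g - g * x) * x - x * (x * g - g * x) = x * (g * x - x * g) - (g * x - x * g) * x.
Proof. by rewrite -[g * x - _]opprB mulrN mulNr opprK addrC. Qed.

Lemma br_linearl g : linear (br^~ g).
Proof. move=> a f h; exact: ring_br_linear mulZr. Qed.

Lemma brN f g : br f g = - br g f. Proof. exact: ring_brN. Qed.

Lemma br_linearr f : linear (br f).
Proof.
move=> a g h; rewrite brN [in RHS]brN (brN f h) (br_linearl f a g h) opprD.
by rewrite scalerN.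
Qed.

Lemma br0 f : br f 0 = 0. Proof. exact: (linear_fun0 (br_linearr f)). Qed.
Lemma brB f g h : br f (g - h) = br f g - br f h.
Proof. exact: (linear_funB g h (br_linearr f)). Qed.
Lemma brZ f a g : br f (a *: g) = a *: br f g.
Proof. exact: (linear_funZ a g (br_linearr f)). Qed.
Lemma brxx f : br f f = 0. Proof. exact: subrr. Qed.

Lemma lie_poly0 : lie_poly 0.
Proof. by have := lie_lin (-1) lie_X lie_X; rewrite scaleN1r addNr. Qed.
Lemma lie_polyZ a f : lie_poly f -> lie_poly (a *: f).
Proof. by move=> Lf; have := lie_lin a Lf lie_poly0; rewrite addr0. Qed.
Lemma lie_polyD f g : lie_poly f -> lie_poly g -> lie_poly (f + g).
Proof. by move=> Lf Lg; have := lie_lin 1 Lf Lg; rewrite scale1r. Qed.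
Lemma lie_polyN f : lie_poly f -> lie_poly (- f).
Proof. by move=> /(lie_polyZ (-1)); rewrite scaleN1r. Qed.
Lemma lie_letter c : lie_poly (mon [:: c]).
Proof. by case: c; [exact: lie_Y|exact: lie_X]. Qed.

(** * Coefficients and derivatives of Lie polynomials *)

Lemma eq_nseq (T : eqType) (s : seq T) m c :
  (s == nseq m c) = (size s == m) && all (pred1 c) s.
Proof.
apply/eqP/andP => [->|[/eqP <- /all_pred1P //]].
by rewrite size_nseq eqxx; split=> //; apply/all_pred1P; rewrite size_nseq.
Qed.

(** The words uv and vu are powers of c simultaneously, so fg and gf agree there. *)
Lemma coef_br_nseq f g m c : coef (br f g) (nseq m c) = 0.
Proof.
rewrite /br coefB; apply/eqP; rewrite subr_eq0; apply/eqP.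
apply: (@bilinear_mon_ext rat^o (fun f g => coef (f * g) (nseq m c))
   (fun f g => coef (g * f) (nseq m c))).
- by move=> k a h l; rewrite mul_linearl coefP.
- by move=> k a h l; rewrite mul_linearr coefP.
- by move=> k a h l; rewrite mul_linearr coefP.
- by move=> k a h l; rewrite mul_linearl coefP.
move=> u v; rewrite !monM !coef_mon !eq_nseq !size_cat !all_cat addnC.
by rewrite [all _ u && _]andbC.
Qed.

Lemma lie_coef_nseq P m c : lie_poly P -> m != 1%N -> coef P (nseq m c) = 0.
Proof.
move=> LP m1; elim: LP => [||a f g _ IHf _ IHg|f g _ _ _ _].
- by rewrite coef_mon eq_nseq /= eq_sym (negPf m1).
- by rewrite coef_mon eq_nseq /= eq_sym (negPf m1).
- by rewrite coefP IHf IHg mulr0 addr0.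
exact: coef_br_nseq.
Qed.

Lemma lie_coef0 P : lie_poly P -> coef P [::] = 0.
Proof. by move=> LP; apply: (@lie_coef_nseq P 0 lx LP). Qed.

Lemma br_scalar1 (a : rat) f : br (a *: 1) f = 0.
Proof. by rewrite /br mulZr mulr1 -scalerAl mul1r subrr. Qed.

(** Once the derivatives of f and g are scalars, they are central, so the derivative of a bracket
    vanishes. *)
Lemma lie_dx P : lie_poly P -> exists a : rat, dx P = a *: 1.
Proof.
elim=> [||a f g _ [b fb] _ [c gc]|f g _ [b fb] _ [c gc]].
- by exists 1; rewrite dx_X scale1r.
- by exists 0; rewrite dx_Y scale0r.
- by exists (a * b + c); rewrite dx_linear fb gc scalerA; apply/esym/scalerDl.
by exists 0; rewrite dx_br fb gc br_scalar1 brN br_scalar1 oppr0 addr0 scale0r.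
Qed.

Lemma lie_dx_eq0 n P : lie_poly P -> homog n P -> n != 1%N -> dx P = 0.
Proof.
move=> LP Pn n1; have [a dP] := lie_dx LP; rewrite dP.
have : coef (dx P) [::] = 0.
  by rewrite coef_dx big_ord1 (homog_coef Pn) // eq_sym.
by rewrite dP coefZ -mon_nil coef_mon mulr1 => ->; rewrite scale0r.
Qed.

(** The Hopf antipode for primitive letters. It is an antiautomorphism that negates Lie polynomials,
    which yields their symmetry under reversal of words. *)
Definition antipode : Qxy -> Qxy :=
  linext (fun w => (-1) ^+ size w *: mon (rev w)).

Lemma antipode_linear : linear antipode.
Proof. exact: linext_linear. Qed.

Lemma antipodeM f g : antipode (f * g) = antipode g * antipode f.
Proof.
apply: (@bilinear_mon_ext _ (fun f g => antipode (f * g))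
                            (fun f g => antipode g * antipode f)).
- by move=> k a h l; rewrite mul_linearl antipode_linear.
- by move=> k a h l; rewrite mul_linearr antipode_linear.
- by move=> k a h l; rewrite antipode_linear mul_linearr.
- by move=> k a h l; rewrite antipode_linear mul_linearl.
move=> u v; rewrite monM /antipode !linext_mon size_cat exprD rev_cat.
by rewrite mulZr -scalerAl monM scalerA.
Qed.

Lemma lie_antipode P : lie_poly P -> antipode P = - P.
Proof.
elim=> [||a f g _ IHf _ IHg|f g _ IHf _ IHg].
- by rewrite /antipode linext_mon scaleN1r.
- by rewrite /antipode linext_mon scaleN1r.
- by rewrite antipode_linear IHf IHg scalerN opprD.
apply: etrans (linear_funB _ _ antipode_linear) _.
apply: etrans (congr2 (fun u v => u - v) (antipodeM f g) (antipodeM g f)) _.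
rewrite IHf IHg; exact: ring_brNN.
Qed.

Lemma coef_antipode f w : coef (antipode f) w = (-1) ^+ size w * coef f (rev w).
Proof.
apply: (@scalar_mon_ext (fun f => coef (antipode f) w)
   (fun f => (-1) ^+ size w * coef f (rev w))).
- by move=> a g h; rewrite antipode_linear coefP.
- by move=> a g h; rewrite coefP mulrDr mulrCA.
move=> u; rewrite /antipode linext_mon coefZ !coef_mon.
rewrite -(inj_eq (can_inj revK)) revK; case: eqP => [->|_]; last by rewrite !mulr0.
by rewrite size_rev.
Qed.

Lemma lie_coef_rev P w :
  lie_poly P -> coef P w = - ((-1) ^+ size w * coef P (rev w)).
Proof.
by move=> LP; rewrite -coef_antipode (lie_antipode LP) coefN opprK.
Qed.

(** [Ad] is the algebra morphism to endomorphisms sending each letter c to [c, .]. It is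
    multiplicative in its first argument and agrees with the bracket only when that argument is
    Lie. *)
Definition Ad_word (u : word) (f : Qxy) : Qxy :=
  foldr (fun c g => br (mon [:: c]) g) f u.
Definition Ad (P f : Qxy) : Qxy := linext (Ad_word^~ f) P.

Lemma Ad_linearl f : linear (Ad^~ f). Proof. exact: linext_linear. Qed.

Lemma Ad_word_linear u : linear (Ad_word u).
Proof.
elim: u => [//|c u IH] a f g /=.
by rewrite IH; apply: br_linearr.
Qed.

Lemma Ad_linearr P : linear (Ad P).
Proof.
move=> a f g.
apply: (@linear_mon_ext _ (fun P => Ad P (a *: f + g)) (fun P => a *: Ad P f + Ad P g)).
- by move=> b h k; rewrite Ad_linearl.
- move=> b h k; rewrite (Ad_linearl f b h k) (Ad_linearl g b h k).
  exact: lmod_lin_swap.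
by move=> u; rewrite /Ad !linext_mon Ad_word_linear.
Qed.

Lemma AdM P Q f : Ad (P * Q) f = Ad P (Ad Q f).
Proof.
apply: (@bilinear_mon_ext _ (fun P Q => Ad (P * Q) f) (fun P Q => Ad P (Ad Q f))).
- by move=> k a h l; rewrite mul_linearl Ad_linearl.
- by move=> k a h l; rewrite mul_linearr Ad_linearl.
- by move=> k a h l; rewrite Ad_linearl.
- by move=> k a h l; rewrite Ad_linearl Ad_linearr.
by move=> u v; rewrite monM /Ad !linext_mon /Ad_word foldr_cat.
Qed.

Lemma Ad_letter c f : Ad (mon [:: c]) f = br (mon [:: c]) f.
Proof. by rewrite /Ad linext_mon. Qed.

Lemma AdB P Q f : Ad (P - Q) f = Ad P f - Ad Q f.
Proof. exact: (linear_funB P Q (Ad_linearl f)). Qed.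

Lemma Ad_lie P f : lie_poly P -> Ad P f = br P f.
Proof.
move=> LP; elim: LP f => [||a p q _ IHp _ IHq|p q _ IHp _ IHq] f.
- exact: Ad_letter.
- exact: Ad_letter.
- by rewrite Ad_linearl IHp IHq br_linearl.
apply: etrans (AdB _ _ _) _.
apply: etrans (congr2 (fun u v => u - v) (AdM p q f) (AdM q p f)) _.
rewrite (IHq f) (IHp f) IHp IHq; exact: ring_jacobi.
Qed.

(** The Dynkin operator: right-normed bracketing of the letters of w. The second summand starts the
    bracketing at the last letter, the only place where the tail is empty. *)
Fixpoint rho_word (w : word) : Qxy :=
  if w is c :: w' then
    br (mon [:: c]) (rho_word w') + (w' == [::])%:R *: mon [:: c]
  else 0.
Definition rho : Qxy -> Qxy := linext rho_word.

Lemma rho_linear : linear rho. Proof. exact: linext_linear. Qed.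

Lemma rho_word_cat u v :
  rho_word (u ++ v) = Ad_word u (rho_word v) + (v == [::])%:R *: rho_word u.
Proof.
case: v => [|l v].
  by rewrite cats0 scale1r (linear_fun0 (Ad_word_linear u)) add0r.
have [r rE] : {r | r = rho_word (l :: v)} by exists (rho_word (l :: v)).
rewrite -rE scale0r addr0; elim: u => [|c u IH]; first by rewrite rE.
apply: etrans (congr1 (br (mon [:: c])) IH); rewrite [LHS]/=.
by rewrite (_ : u ++ l :: v == [::] = false) ?scale0r ?addr0 //; case: (u).
Qed.

Lemma rhoM P Q : rho (P * Q) = Ad P (rho Q) + coef Q [::] *: rho P.
Proof.
apply: (@bilinear_mon_ext _ (fun P Q => rho (P * Q))
   (fun P Q => Ad P (rho Q) + coef Q [::] *: rho P)).
- by move=> k a h l; rewrite mul_linearl rho_linear.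
- by move=> k a h l; rewrite mul_linearr rho_linear.
- by move=> k a h l; rewrite Ad_linearl rho_linear; apply: lmod_linDr.
- by move=> k a h l; rewrite rho_linear Ad_linearr coefP; apply: lmod_linD.
by move=> u v; rewrite monM /rho !linext_mon /Ad linext_mon coef_mon rho_word_cat.
Qed.

Lemma rhoB P Q : rho (P - Q) = rho P - rho Q.
Proof. exact: (linear_funB P Q rho_linear). Qed.

Lemma rho_letter c : rho (mon [:: c]) = mon [:: c].
Proof. by rewrite /rho linext_mon /= br0 add0r scale1r. Qed.

Lemma lie_rho P : lie_poly (rho P).
Proof.
elim/mon_ind: P => [|a w f IH].
  by rewrite (linear_fun0 rho_linear); apply: lie_poly0.
rewrite rho_linear; apply: lie_lin IH; rewrite /rho linext_mon.
elim: w => [|c w IH] /=; first exact: lie_poly0.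
apply: lie_polyD; first exact: lie_br (lie_letter c) IH.
exact: lie_polyZ (lie_letter c).
Qed.

Definition euler : Qxy -> Qxy := der (fun c => mon [:: c]).

Lemma euler_mon w : euler (mon w) = (size w)%:R *: mon w.
Proof.
rewrite /euler /der linext_mon; elim: w => [|c w IH] /=; first by rewrite scale0r.
by rewrite IH mulZr monM /= -natr1 scalerDl scale1r addrC.
Qed.

Lemma coef_euler f w : coef (euler f) w = (size w)%:R * coef f w.
Proof.
apply: (@scalar_mon_ext (fun f => coef (euler f) w)
  (fun f => (size w)%:R * coef f w)).
- by move=> a g h; rewrite /euler der_linear coefP.
- by move=> a g h; rewrite coefP mulrDr mulrCA.
move=> u; rewrite euler_mon coefZ coef_mon.
by case: eqP => [->|_]; rewrite ?mulr0.
Qed.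

Lemma homog_euler n f : homog n f -> euler f = n%:R *: f.
Proof.
move=> fn; apply: coef_ext => w; rewrite coef_euler coefZ.
have [->//|wn] := eqVneq (size w) n.
by rewrite (homog_coef fn wn) !mulr0.
Qed.

(* The Dynkin-Specht-Wever theorem. *)
Lemma lie_rho_euler P : lie_poly P -> rho P = euler P.
Proof.
elim=> [||a f g _ IHf _ IHg|f g Lf IHf Lg IHg].
- by rewrite rho_letter /euler der_mon1.
- by rewrite rho_letter /euler der_mon1.
- by rewrite rho_linear IHf IHg /euler der_linear.
(* A Lie polynomial has no constant term and acts through [Ad] as a bracket, so [rho] acts only on
   the right factor. Antisymmetrizing makes it a derivation on Lie polynomials, as [euler] is. *)
have rfg p q : lie_poly p -> lie_poly q -> rho (p * q) = br p (rho q).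
  by move=> Lp Lq; rewrite rhoM (lie_coef0 Lq) scale0r addr0 (Ad_lie _ Lp).
apply: etrans (rhoB _ _) _.
apply: etrans (congr2 (fun u v => u - v) (rfg _ _ Lf Lg) (rfg _ _ Lg Lf)) _.
rewrite IHf IHg (brN g) opprK addrC; exact/esym/der_br.
Qed.

(** Since cU = Uc, a leading c of a word can be moved to its end without changing the coefficient.
    When another letter reaches the front, that coefficient of cU is 0. The extra suffix v in the
    induction collects the letters moved. *)
Lemma br_letter_eq0 c U w :
  br (mon [:: c]) U = 0 -> ~~ all (pred1 c) w -> coef U w = 0.
Proof.
move=> cU; rewrite -[w in coef U w]cats0; move: [::].
have comm v : coef U v = coef (mon [:: c] * U) (rcons v c).
  by rewrite -(subrK (U * mon [:: c]) (mon [:: c] * U)) (cU : _ - _ = 0) add0r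
    coef_mulr_letter eqxx.
elim: w => [//|l w IH] v /=; rewrite negb_and comm /= coef_mull_letter.
by case: (l =P c) => //= _ wc; rewrite rcons_cat IH.
Qed.

Lemma br_letter_inj c U :
  br (mon [:: c]) U = 0 -> (forall m, coef U (nseq m c) = 0) -> U = 0.
Proof.
move=> cU U0; apply: coef_ext => w; rewrite coef0.
have [/all_pred1P -> //|wc] := boolP (all (pred1 c) w).
exact: br_letter_eq0 cU wc.
Qed.

Lemma coef_Ad_nseq P f m c :
  coef (Ad P f) (nseq m c) = coef P [::] * coef f (nseq m c).
Proof.
apply: (@scalar_mon_ext (fun P => coef (Ad P f) (nseq m c))
  (fun P => coef P [::] * coef f (nseq m c))).
- by move=> a g h; rewrite Ad_linearl coefP.
- by move=> a g h; rewrite coefP mulrDl mulrA.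
case=> [|l u]; rewrite /Ad linext_mon coef_mon /= ?mul1r // mul0r.
exact: coef_br_nseq.
Qed.

Lemma coef_rho_letter P c : coef (rho P) [:: c] = coef P [:: c].
Proof.
apply: (@scalar_mon_ext (fun P => coef (rho P) [:: c]) (fun P => coef P [:: c])).
- by move=> a g h; rewrite rho_linear coefP.
- by move=> a g h; rewrite coefP.
case=> [|l u]; rewrite /rho linext_mon coef_mon ?coef0 //=.
rewrite coefD coefZ coef_mon (coef_br_nseq _ _ 1 c) add0r !eqseq_cons eqxx andbT.
by rewrite mulr_natl mulrb; case: (u == [::]); rewrite ?andbT ?andbF.
Qed.

(* [Ad G X = [G, X]] because the difference commutes with [X]; comparing the
   two expressions of [rho [X, G]] then gives [rho G = n G]. *)
Lemma lie_br_X n G : (1 < n)%N -> homog n G -> dx G = 0 ->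
  lie_poly (br X G) -> lie_poly G.
Proof.
move=> n1 Gn dG LXG.
have G0 : coef G [::] = 0 by rewrite (homog_coef Gn) // eq_sym -lt0n (ltnW n1).
have AdGX : Ad G X = br G X.
  apply/eqP; rewrite -subr_eq0; apply/eqP; apply: (@br_letter_inj lx) => [|m].
    apply: etrans (brB _ _ _) _; rewrite -/X.
    (* By multiplicativity and [X,X] = 0. On the other hand [X,G] is Lie, so the left side is
       [[X,G],X] = [X,[G,X]], and the difference to be killed commutes with X. *)
    have <- : Ad (br X G) X = br X (Ad G X).
      apply: etrans (AdB _ _ _) _.
      apply: etrans (congr2 (fun u v => u - v) (AdM X G X) (AdM G X X)) _.
      rewrite (@Ad_letter lx X) (brxx X) (linear_fun0 (Ad_linearr G)) subr0.
      exact: (@Ad_letter lx).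
    rewrite (Ad_lie X LXG); apply: etrans (congr1 (+%R^~ _) (ring_brbr _ _)) _.
    exact: subrr.
  by rewrite coefB coef_Ad_nseq G0 mul0r (coef_br_nseq G X) subrr.
(* [X,G] is Lie of degree n+1, so [rho] multiplies it by n+1; expanding the product instead gives
   [X, rho G] - [G,X], which absorbs one of the n+1 copies. *)
have rhoXG : br X (rho G) = n%:R *: br X G.
  have XGn : homog n.+1 (br X G).
    rewrite /br -scaleN1r addrC; apply: homog_lin.
      exact: homog_mulr.
    exact: homog_mull.
  have := lie_rho_euler LXG; rewrite (homog_euler XGn).
  have -> : rho (br X G) = br X (rho G) - br G X.
    apply: etrans (rhoB _ _) _; congr (_ - _).
      rewrite rhoM G0 scale0r addr0; exact: (@Ad_letter lx).
    by rewrite rhoM (lie_coef0 lie_X) scale0r addr0 (@rho_letter lx) AdGX.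
  rewrite (brN G X) opprK -natr1 scalerDl scale1r; exact: addIr.
have nV : n%:R != 0 :> rat by rewrite Num.Theory.pnatr_eq0 -lt0n (ltnW n1).
suff rG : rho G = n%:R *: G.
  have := lie_polyZ n%:R^-1 (lie_rho G).
  by move: (rho G) rG => r ->; rewrite scalerA mulVf // scale1r.
apply/eqP; rewrite -subr_eq0; apply/eqP; apply: (@br_letter_inj lx) => [|m].
  by apply: etrans (brB _ _ _) _; rewrite -/X rhoXG brZ subrr.
rewrite coefB coefZ; have [->|m1] := eqVneq m 1%N.
  by rewrite coef_rho_letter (homog_coef Gn) ?mulr0 ?subr0 // eq_sym gtn_eqF.
rewrite (lie_coef_nseq lx (lie_rho G) m1) sub0r.
have [->|mn] := eqVneq m n; last first.
  by rewrite (homog_coef Gn) ?size_nseq // mulr0 oppr0.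
(* Commutation with X says nothing about powers of x. This is where [dx G = 0] enters: all n
   insertions of x into the word x^(n-1) give x^n, so n times that coefficient is 0. *)
have : coef (dx G) (nseq n.-1 lx) = n%:R * coef G (nseq n lx).
  rewrite coef_dx size_nseq prednK ?(ltnW n1) // mulr_natl -[n in _ *+ n]card_ord.
  rewrite -sumr_const; apply: eq_bigr => i _; congr coef.
  apply/eqP; rewrite eq_nseq all_cat /= size_cat /= addnS -size_cat cat_take_drop.
  rewrite size_nseq prednK ?(ltnW n1) // eqxx /= -all_cat.
  by rewrite cat_take_drop all_pred1_nseq.
by rewrite dG coef0 => <-; rewrite oppr0.
Qed.

(** * Special pairs and push-invariance *)

(* [H] plays the role of xG + yF = Gx + Fy. *)
Definition cyclic_potential (F G H : Qxy) : Prop :=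
  [/\ forall u, coef H (lx :: u) = coef G u,
      forall u, coef H (ly :: u) = coef F u &
      forall u v, coef H (u ++ v) = coef H (v ++ u)].

Lemma coefD_mull f g l u :
  coef (mon [:: lx] * f + mon [:: ly] * g) (l :: u) = coef (if l then g else f) u.
Proof.
apply: etrans (coefD _ _ _) _.
apply: etrans (congr2 +%R (coef_mull_letter _ _ _ _) (coef_mull_letter _ _ _ _)) _.
by case: l; rewrite /= ?addr0 ?add0r.
Qed.

Lemma coefD_mulr f g l u :
  coef (f * mon [:: lx] + g * mon [:: ly]) (rcons u l) = coef (if l then g else f) u.
Proof.
apply: etrans (coefD _ _ _) _.
apply: etrans (congr2 +%R (coef_mulr_letter _ _ _ _) (coef_mulr_letter _ _ _ _)) _.
by case: l; rewrite /= ?addr0 ?add0r.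
Qed.

Lemma coef_br_letter c f l u d :
  coef (br (mon [:: c]) f) (l :: rcons u d) =
  (if l == c then coef f (rcons u d) else 0) - (if d == c then coef f (l :: u) else 0).
Proof.
apply: etrans (coefB _ _ _) _.
exact: (congr2 (fun a b => a - b) (coef_mull_letter _ _ _ _)
  (coef_mulr_letter _ _ (l :: u) d)).
Qed.

Lemma coef_br_letter1 c f l : coef (br (mon [:: c]) f) [:: l] = 0.
Proof.
apply: etrans (coefB _ _ _) _.
apply: etrans (congr2 (fun a b => a - b) (coef_mull_letter _ _ _ _)
  (coef_mulr_letter _ _ [::] _)) _.
exact: subrr.
Qed.

Lemma special_potential F G :
  br X G + br Y F = 0 -> exists H, cyclic_potential F G H.
Proof.
move=> sp; exists (X * G + Y * F).
have HE : X * G + Y * F = G * X + F * Y.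
  by apply/eqP; rewrite -subr_eq0 opprD addrACA; apply/eqP.
have HX u : coef (X * G + Y * F) (lx :: u) = coef G u by exact: coefD_mull.
have HY u : coef (X * G + Y * F) (ly :: u) = coef F u by exact: coefD_mull.
have Hr c u : coef (X * G + Y * F) (c :: u) = coef (X * G + Y * F) (rcons u c).
  apply: etrans (coefD_mull _ _ _ _) _; rewrite HE; apply: esym.
  exact: coefD_mulr.
move: (X * G + Y * F) HX HY Hr => H HX HY Hr.
split; [exact: HX|exact: HY|]; elim=> [|c u IH] v; first by rewrite cats0.
by rewrite cat_cons Hr rcons_cat IH cat_rcons.
Qed.

Lemma potential_rcofF F G H (FGH : cyclic_potential F G H) u :
  coef F (rcons u ly) = coef F (ly :: u).
Proof. by case: FGH => _ HY Hc; rewrite -!HY -cats1 -cat_cons Hc. Qed.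

Lemma potential_rcofG F G H (FGH : cyclic_potential F G H) u :
  coef G (rcons u ly) = coef F (lx :: u).
Proof. by case: FGH => HX HY Hc; rewrite -HX -HY -cats1 -cat_cons Hc. Qed.

(** Both sides are coefficients of H at rotations of one cyclic word; marking an x in it gives G,
    marking a y gives F. *)
Lemma potential_swap F G H (FGH : cyclic_potential F G H) u v :
  coef G (v ++ ly :: u) = coef F (u ++ lx :: v).
Proof.
by case: FGH => HX HY Hc; rewrite -HX -HY -!cat_cons Hc.
Qed.

Lemma potential_rot F G H (FGH : cyclic_potential F G H) u v :
  coef F (u ++ ly :: v) = coef F (v ++ ly :: u).
Proof. by case: FGH => HX HY Hc; rewrite -!HY -!cat_cons Hc. Qed.

Definition proj_deg n : Qxy -> Qxy :=
  linext (fun w => if size w == n then mon w else 0).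

Lemma coef_proj_deg n f w :
  coef (proj_deg n f) w = if size w == n then coef f w else 0.
Proof.
apply: (@scalar_mon_ext (fun f => coef (proj_deg n f) w)
  (fun f => if size w == n then coef f w else 0)).
- by move=> a g h; rewrite /proj_deg linext_linear coefP.
- by move=> a g h; rewrite coefP; case: ifP => // _; rewrite mulr0 addr0.
move=> u; rewrite /proj_deg linext_mon.
have [<-|uw] := eqVneq u w; first by case: ifP; rewrite ?coef0.
by do 2 case: ifP => _; rewrite ?coef0 // coef_mon (negPf uw).
Qed.

(** The degree n+1 component of s(h) is again killed by [dx] and has right y-part h, so uniqueness
    makes it all of s(h). *)
Lemma homog_smap n h : homog n h -> homog n.+1 (s_map h).
Proof.
move=> hn; suff <- : proj_deg n.+1 (s_map h) = s_map h.
  by move=> w; rewrite coef_proj_deg; case: (size w =P n.+1) => // _; rewrite eqxx.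
have size_ins (w : word) i : size (take i w ++ lx :: drop i w) = (size w).+1.
  by rewrite size_cat /= addnS -size_cat cat_take_drop.
apply: smap_unique; last by rewrite coef_proj_deg.
  apply: coef_ext => w; rewrite coef_dx coef0.
  have [wn|wn] := eqVneq (size w) n.
    rewrite -[RHS](coef0 w) -(dx_smap h) coef_dx; apply: eq_bigr => i _.
    by rewrite coef_proj_deg size_ins eqSS (introT eqP wn).
  by rewrite big1 // => i _; rewrite coef_proj_deg size_ins eqSS (negPf wn).
apply: coef_ext => w; rewrite coef_rcof coef_proj_deg size_rcons eqSS.
rewrite -coef_rcof rcofy_smap; have [//|wn] := eqVneq (size w) n.
by rewrite (homog_coef hn).
Qed.

Lemma homog_lcof n l F : homog n.+1 F -> homog n (lcof l F).
Proof. by move=> Fn w; rewrite coef_lcof => /Fn []. Qed.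

Lemma br1 f : br 1 f = 0.
Proof. by have := br_scalar1 1 f; rewrite scale1r. Qed.

Lemma br_special_smap F : dx F = 0 -> rcof ly F = lcof ly F ->
  br X (s_map (lcof lx F)) + br Y F = 0.
Proof.
move=> dF Fy; set G := s_map _.
have GF u : coef G (rcons u ly) = coef F (lx :: u).
  by rewrite -coef_rcof rcofy_smap coef_lcof.
have FF u : coef F (rcons u ly) = coef F (ly :: u).
  by rewrite -coef_rcof Fy coef_lcof.
apply: dx_rcofy_eq0.
- have brD0 f g : br (dx f) g = 0 -> br f (dx g) = 0 -> dx (br f g) = 0.
    by move=> e1 e2; apply: etrans (dx_br _ _) _; rewrite e1 e2 addr0.
  apply: etrans (dxD _ _) _.
  apply: etrans (congr2 +%R (brD0 _ _ _ _) (brD0 _ _ _ _)) (addr0 0).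
  - by rewrite dx_X; apply: br1.
  - by rewrite (dx_smap _ : dx G = 0); apply: br0.
  - by rewrite dx_Y brN br0 oppr0.
  by rewrite dF; apply: br0.
- apply: coef_ext => u; rewrite coef_rcof coef0; apply: etrans (coefD _ _ _) _.
  case: u => [|l u].
    exact: etrans (congr2 +%R (coef_br_letter1 lx G ly) (coef_br_letter1 ly F ly))
      (addr0 0).
  (* At a word l u y the bracket with X loses its second half. For l = y the sum is (F|uy) - (F|yu),
     for l = x it is (G|uy) - (F|xu); both vanish by [FF] and [GF]. *)
  apply: etrans (congr2 +%R (coef_br_letter lx G l u ly) (coef_br_letter ly F l u ly)) _.
  rewrite /=; case: l => /=; first by rewrite FF !subr0 add0r subrr.
  by rewrite GF subr0 sub0r subrr.
apply: etrans (coefD _ _ _) _.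
exact: etrans (congr2 +%R (coef_br_nseq X G 0 lx) (coef_br_nseq Y F 0 lx)) (addr0 0).
Qed.

Lemma special_smap n F G : (1 < n)%N -> lie_poly G -> homog n G ->
  br X G + br Y F = 0 -> G = s_map (lcof lx F).
Proof.
move=> n1 LG Gn /special_potential[H FGH]; apply: smap_unique.
- by apply: lie_dx_eq0 LG Gn _; rewrite gtn_eqF.
- by apply: coef_ext => u; rewrite coef_rcof coef_lcof (potential_rcofG FGH).
exact: lie_coef0.
Qed.

Lemma lie_smap n F : (1 < n)%N -> lie_poly F -> homog n F ->
  rcof ly F = lcof ly F ->
  let G := s_map (lcof lx F) in
  [/\ lie_poly G, homog n G & br X G + br Y F = 0].
Proof.
move=> n1 LF Fn Fy G.
have dF : dx F = 0 by apply: lie_dx_eq0 LF Fn _; rewrite gtn_eqF.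
have sp : br X G + br Y F = 0 by apply: br_special_smap.
have Gn : homog n G.
  by case: n n1 Fn => // n n1 Fn; apply/homog_smap/homog_lcof.
split=> //; apply: lie_br_X n1 Gn (dx_smap _) _.
move/eqP: sp; rewrite addr_eq0 => /eqP ->.
exact/lie_polyN/lie_br/LF/lie_Y.
Qed.

(** The word with a y appended. Every exponent is then followed by a y, so the last one is no longer
    special, and [push] becomes a rotation by one whole block. *)
Definition blocks (s : seq nat) : word :=
  flatten [seq nseq a lx ++ [:: ly] | a <- s].

Lemma blocks_rcons s a : blocks (rcons s a) = blocks s ++ nseq a lx ++ [:: ly].
Proof. by rewrite /blocks map_rcons flatten_rcons. Qed.

Lemma blocks_word_exps w : blocks (word_exps w) = rcons w ly.
Proof.
have ne u : word_exps u != [::] by case: u => //= c u; case: ifP.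
elim: w => [//|c w IH] /=; move: (ne w) IH.
by case: (word_exps w) => [//|a s] _ <-; case: c.
Qed.

Lemma size_word_exps w : size (word_exps w) = (count_mem ly w).+1.
Proof.
elim: w => [//|c w IH] /=; case: c => /=; first by rewrite IH.
by rewrite size_behead IH.
Qed.

Lemma rcons_exps_word s : s != [::] -> rcons (exps_word s) ly = blocks s.
Proof.
case: s => [//|a s _]; elim: s a => [|b s IH] a.
  by rewrite /exps_word /blocks /= !cats0 cats1.
rewrite (_ : exps_word (a :: b :: s) = nseq a lx ++ ly :: exps_word (b :: s)) //.
by rewrite rcons_cat rcons_cons IH -[ly :: blocks _]cat1s catA.
Qed.

Lemma exps_wordK s : s != [::] -> word_exps (exps_word s) = s.
Proof.
have addx a u : word_exps (nseq a lx ++ u) =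
    (a + head 0%N (word_exps u))%N :: behead (word_exps u).
  elim: a => [|a IH] /=; last by rewrite IH.
  by case E: (word_exps u) => //; have := size_word_exps u; rewrite E.
case: s => [//|a s _]; elim: s a => [|b s IH] a.
  by rewrite /exps_word addx /= addn0.
by rewrite /exps_word addx /= -[nseq b _ ++ _]/(exps_word (b :: s)) IH /= addn0.
Qed.

Lemma word_exps_neq0 w : word_exps w != [::].
Proof. by rewrite -size_eq0 size_word_exps. Qed.

Lemma word_expsK : cancel word_exps exps_word.
Proof.
move=> w; have := rcons_exps_word (word_exps_neq0 w).
by rewrite blocks_word_exps => /rcons_inj[].
Qed.

Lemma blocks_rev s : ly :: blocks (rev s) = rcons (rev (blocks s)) ly.
Proof.
elim: s => [//|a s IH]; rewrite rev_cons blocks_rcons -cat_cons IH.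
rewrite {2}/blocks /= !rev_cat rev_cons /= -/(blocks s) rcons_cat -!cats1 -!catA.
congr (_ ++ _); rewrite /= (_ : rev (nseq a lx) = nseq a lx) //.
by apply/eqP; rewrite eq_nseq size_rev size_nseq eqxx all_rev all_pred1_nseq.
Qed.

Lemma anti_wordE w : anti_word w = rev w.
Proof.
have ne : rev (word_exps w) != [::].
  by rewrite -size_eq0 size_rev size_word_exps.
have := blocks_rev (word_exps w).
rewrite -rcons_exps_word // blocks_word_exps rev_rcons rcons_cons.
by case=> /rcons_inj[].
Qed.

Lemma coef_anti f w : coef (anti f) w = coef f (rev w).
Proof.
apply: (@scalar_mon_ext (fun f => coef (anti f) w) (fun f => coef f (rev w))).
- by move=> a g h; rewrite /anti linext_linear coefP.
- by move=> a g h; rewrite coefP.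
move=> u; rewrite /anti linext_mon !coef_mon anti_wordE.
by rewrite -(inj_eq (can_inj revK)) revK.
Qed.

(** The reversal symmetry of Lie polynomials turns (F | rev(w) y) into (F | y w) with sign
    (-1)^(n-1), exactly the sign in the definition of antipalindromic. *)
Lemma antipalindromicP n F : lie_poly F -> homog n F ->
  antipalindromic n.-1 (rcof ly F) <-> rcof ly F = lcof ly F.
Proof.
move=> LF Fn.
have key w : size w = n.-1 ->
    (-1) ^+ n.-1 * coef F (rcons (rev w) ly) = coef F (ly :: w).
  move=> wn; rewrite (lie_coef_rev _ LF) size_rcons size_rev rev_rcons revK wn.
  by rewrite exprS mulN1r mulNr opprK signrMK.
(* For n = 0 the predecessor truncates, but then F = 0. *)
case: n Fn key => [|n] Fn /= key.
  have F0 : F = 0.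
    apply: coef_ext => w; rewrite coef0; have [/size0nil ->|w0] := eqVneq (size w) 0%N.
      exact: lie_coef0.
    exact: homog_coef Fn w0.
  rewrite F0 (linear_fun0 (rcof_linear ly)) (linear_fun0 (lcof_linear ly)).
  by split=> // _; rewrite /antipalindromic /anti (linear_fun0 (linext_linear _)) scaler0.
split=> [ap|Fy].
  apply: coef_ext => w; rewrite coef_lcof.
  have [wn|wn] := eqVneq (size w) n.
    by rewrite ap coefZ coef_anti coef_rcof key.
  by rewrite coef_rcof !(homog_coef Fn) //= ?size_rcons eqSS.
rewrite /antipalindromic; apply: coef_ext => w; rewrite coefZ coef_anti.
have [wn|wn] := eqVneq (size w) n.
  by rewrite [in RHS]coef_rcof key // Fy coef_lcof.
by rewrite !coef_rcof !(homog_coef Fn) ?mulr0 // size_rcons ?size_rev eqSS.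
Qed.

(** * The action of push on words and push-invariance *)

Lemma push_wordE s a : push_word (exps_word (rcons s a)) = exps_word (a :: s).
Proof. by rewrite /push_word exps_wordK ?rotr1_rcons // -size_eq0 size_rcons. Qed.

Lemma rcons_push_word s a :
  rcons (push_word (exps_word (rcons s a))) ly = nseq a lx ++ [:: ly] ++ blocks s.
Proof. by rewrite push_wordE rcons_exps_word // /blocks /= -catA. Qed.

Definition pull_word (w : word) : word := exps_word (rot 1 (word_exps w)).

Lemma push_wordK : cancel push_word pull_word.
Proof.
move=> w; rewrite /push_word /pull_word exps_wordK ?rotrK ?word_expsK //.
by rewrite -size_eq0 size_rotr size_word_exps.
Qed.

Lemma pull_wordK : cancel pull_word push_word.
Proof.
move=> w; rewrite /push_word /pull_word exps_wordK ?rotK ?word_expsK //.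
by rewrite -size_eq0 size_rot size_word_exps.
Qed.

Lemma coef_push f w : coef (push f) (push_word w) = coef f w.
Proof.
apply: (@scalar_mon_ext (fun f => coef (push f) (push_word w)) (fun f => coef f w)).
- by move=> a g h; rewrite /push linext_linear coefP.
- by move=> a g h; rewrite coefP.
move=> u; rewrite /push linext_mon !coef_mon.
by rewrite (inj_eq (can_inj push_wordK)).
Qed.

Lemma push_invariantP f :
  push_invariant f <-> forall w, coef f (push_word w) = coef f w.
Proof.
split=> [fE w|fE]; first by rewrite -{1}fE coef_push.
by apply: coef_ext => w; rewrite -[w]pull_wordK coef_push fE.
Qed.

Lemma push_word_rcons u : push_word (rcons u ly) = ly :: u.
Proof.
have -> : rcons u ly = exps_word (rcons (word_exps u) 0).
  apply: (@rcons_injl _ ly); rewrite rcons_exps_word.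
    by rewrite blocks_rcons blocks_word_exps /= cats1.
  by rewrite -size_eq0 size_rcons.
apply: (@rcons_injl _ ly); rewrite rcons_push_word /= blocks_word_exps.
by [].
Qed.

Lemma push_invariant_rcof F : push_invariant F -> rcof ly F = lcof ly F.
Proof.
move=> /push_invariantP Fp; apply: coef_ext => u.
by rewrite coef_rcof coef_lcof -Fp push_word_rcons.
Qed.

(** (F|w) is the coefficient of H at y w, hence at w y. Pushing w moves the last block of w y to the
    front, which is a rotation, and H does not notice. *)
Lemma special_push_invariant F G : br X G + br Y F = 0 -> push_invariant F.
Proof.
move=> /special_potential[H [_ HY Hc]]; apply/push_invariantP => w.
rewrite -!HY -[w]word_expsK; case/lastP: (word_exps w) (word_exps_neq0 w) => // s a _.
rewrite -[ly :: push_word _]cat1s Hc cats1 rcons_push_word.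
rewrite -[ly :: exps_word _]cat1s [in RHS]Hc cats1 rcons_exps_word; last first.
  by rewrite -size_eq0 size_rcons.
by rewrite blocks_rcons catA Hc.
Qed.

(** Left to right passes through the special pair: F_y = F^y only compares words ending in y with
    words starting with y, but it makes (F, s(F^x)) special, and this forces invariance on all
    words. *)
Lemma antipalindromic_push n F : (1 < n)%N -> lie_poly F -> homog n F ->
  antipalindromic n.-1 (rcof ly F) <-> push_invariant F.
Proof.
move=> n1 LF Fn; rewrite (antipalindromicP LF Fn); split=> [Fy|].
  by have [_ _ /special_push_invariant] := lie_smap n1 LF Fn Fy.
exact: push_invariant_rcof.
Qed.

(** * Traces and push-constance *)

(** The functionals that detect the image in TR. A periodic word is counted with multiplicity, so
    the number of terms is always [size w]. *)
Definition rotsum (f : Qxy) (w : word) : rat := \sum_(i < size w) coef f (rot i w).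

Lemma rotsumP a f g w : rotsum (a *: f + g) w = a * rotsum f w + rotsum g w.
Proof.
rewrite /rotsum mulr_sumr -big_split; apply: eq_bigr => i _; exact: coefP.
Qed.

Lemma rotsumB f g w : rotsum (f - g) w = rotsum f w - rotsum g w.
Proof. by rewrite /rotsum -sumrB; apply: eq_bigr => i _; exact: coefB. Qed.

Lemma sum_rotS (phi : word -> rat) w :
  \sum_(i < size w) phi (rot i.+1 w) = \sum_(i < size w) phi (rot i w).
Proof.
case: w => [|c w]; first by rewrite !big_ord0.
by rewrite big_ord_recr big_ord_recl /= rot0 addrC -[(size w).+1]/(size (c :: w)) rot_size.
Qed.

Lemma sum_rot (phi : word -> rat) k w :
  \sum_(i < size w) phi (rot i (rot k w)) = \sum_(i < size w) phi (rot i w).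
Proof.
elim: k => [|k IH]; first by rewrite rot0.
have [kw|kw] := ltnP k (size w); last by rewrite rot_oversize // leqW.
have step u : \sum_(i < size u) phi (rot i (rot 1 u)) = \sum_(i < size u) phi (rot i u).
  by rewrite -sum_rotS; apply: eq_bigr => i _; rewrite rot_rot -rotS.
by rewrite -IH (rotS kw); have := step (rot k w); rewrite size_rot.
Qed.

Lemma rotsum_rot f k w : rotsum f (rot k w) = rotsum f w.
Proof. by rewrite /rotsum size_rot sum_rot. Qed.

Lemma rotsum_comm f g w : rotsum (f * g) w = rotsum (g * f) w.
Proof.
apply: (@bilinear_mon_ext rat^o (fun f g => rotsum (f * g) w)
   (fun f g => rotsum (g * f) w)).
- by move=> k a h l; rewrite mul_linearl rotsumP.
- by move=> k a h l; rewrite mul_linearr rotsumP.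
- by move=> k a h l; rewrite mul_linearr rotsumP.
- by move=> k a h l; rewrite mul_linearl rotsumP.
move=> u v; rewrite !monM -[RHS](rotsum_rot _ (size u)) /rotsum size_rot.
apply: eq_bigr => i _; rewrite !coef_mon rot_rot -(rot_size_cat u v).
by rewrite (inj_eq (@rot_inj _ _)).
Qed.

Lemma rotsum_span f w : f \in Defs.span commutator -> rotsum f w = 0.
Proof.
move/asboolP => [k [c [u [Su ->]]]].
have rotsum0 : rotsum 0 w = 0 by rewrite /rotsum big1 // => i _; apply: coef0.
elim/big_rec: _ => [//|i x _ IH]; rewrite rotsumP IH addr0.
have [a [b ->]] := Su i.
rewrite (_ : rotsum _ w = 0) ?mulr0 //; apply: etrans (rotsumB _ _ _) _.
exact: etrans (congr1 (fun x => x - _) (rotsum_comm a b w)) (subrr _).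
Qed.

Lemma mon_rotr_span i u : mon u - mon (rotr i u) \in Defs.span commutator.
Proof.
apply: span_gen; exists (mon (drop i (rotr i u))), (mon (take i (rotr i u))).
by rewrite !monM cat_take_drop -[_ ++ _]/(rot i _) rotrK.
Qed.

Lemma coef_rotr i f w : coef (linext (fun u => mon (rotr i u)) f) w = coef f (rot i w).
Proof.
apply: (@scalar_mon_ext (fun f => coef (linext (fun u => mon (rotr i u)) f) w)
   (fun f => coef f (rot i w))).
- by move=> a g h; rewrite linext_linear coefP.
- by move=> a g h; rewrite coefP.
by move=> u; rewrite linext_mon !coef_mon -(inj_eq (@rot_inj i _)) rotrK.
Qed.

Lemma lmod_subD (V : lmodType rat) (a : rat) (u v u' v' : V) :
  (a *: u + v) - (a *: u' + v') = a *: (u - u') + (v - v').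
Proof. by rewrite opprD addrACA scalerBr. Qed.

Lemma rotr_span i f : f - linext (fun u => mon (rotr i u)) f \in Defs.span commutator.
Proof.
elim/mon_ind: f => [|a u f IH].
  by rewrite (linear_fun0 (linext_linear _)) subr0 rpred0.
rewrite linext_linear lmod_subD linext_mon.
by apply: rpredD IH; apply: rpredZ; apply: mon_rotr_span.
Qed.

(** Averaging: the n rotations [R i] of f sum to 0 by hypothesis, so n f is the sum of the f -
    [R i], each a combination of commutators; then divide by n. *)
Lemma rotsum0_span n f : (0 < n)%N -> homog n f ->
  (forall w, size w = n -> rotsum f w = 0) -> f \in Defs.span commutator.
Proof.
move=> n0 fn f0.
pose R i := linext (fun u => mon (rotr i u)) f.
have sumR : \sum_(i < n) R i = 0.
  apply: coef_ext => w; rewrite coef_sum coef0.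
  have [wn|wn] := eqVneq (size w) n.
    by rewrite -[RHS](f0 w wn) /rotsum wn; apply: eq_bigr => i _; apply: coef_rotr.
  by rewrite big1 // => i _; rewrite coef_rotr (homog_coef fn) // size_rot.
have : n%:R *: f = \sum_(i < n) (f - R i).
  by rewrite sumrB sumR subr0 sumr_const card_ord scaler_nat.
move/(congr1 (fun h => n%:R^-1 *: h)).
rewrite scalerA mulVf ?Num.Theory.pnatr_eq0 -?lt0n // scale1r => ->.
by apply: rpredZ; apply: rpred_sum => i _; apply: rotr_span.
Qed.

Lemma homogD n f g : homog n f -> homog n g -> homog n (f + g).
Proof. by move=> fn gn; rewrite -[f]scale1r; apply: homog_lin. Qed.

Lemma homogB n f g : homog n f -> homog n g -> homog n (f - g).
Proof.
by move=> fn gn; rewrite -scaleN1r addrC; apply: homog_lin.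
Qed.

Lemma tr_eqP n f g : (0 < n)%N -> homog n f -> homog n g ->
  tr f = tr g <-> forall w, size w = n -> rotsum f w = rotsum g w.
Proof.
move=> n0 fn gn.
split=> [fg w _|fg].
  have /eqP := fg; rewrite trP => /(@rotsum_span _ w).
  by rewrite rotsumB => /eqP; rewrite subr_eq0 => /eqP.
apply/eqP; rewrite trP; apply: (rotsum0_span n0 (homogB fn gn)) => w wn.
by rewrite rotsumB fg // subrr.
Qed.

(** * Rotation sums of the right-hand side of the trace condition *)

Lemma coef_expXY n w : coef ((X + Y) ^+ n) w = (size w == n)%:R.
Proof.
elim: n w => [|n IH] w.
  by rewrite expr0 -mon_nil coef_mon size_eq0 eq_sym.
rewrite exprS mulrDl; case: w => [|l w].
  by rewrite coefD; apply: etrans (congr2 +%R (coef_mull_letter0 _ _)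
    (coef_mull_letter0 _ _)) (addr0 0).
by apply: etrans (coefD_mull _ _ _ _) _; rewrite if_same IH.
Qed.

Lemma mon_nseq c n : mon [:: c] ^+ n = mon (nseq n c).
Proof. by elim: n => [|n IH]; rewrite ?expr0 ?mon_nil // exprS IH monM. Qed.

Definition trace_poly n : Qxy := (X + Y) ^+ n - X ^+ n - Y ^+ n.

Lemma coef_trace_poly n w : coef (trace_poly n) w =
  (size w == n)%:R - (nseq n lx == w)%:R - (nseq n ly == w)%:R.
Proof.
have coefXn c : coef (mon [:: c] ^+ n) w = (nseq n c == w)%:R.
  by rewrite mon_nseq coef_mon.
apply: etrans (coefB _ _ _) _.
apply: (congr2 (fun a b => a - b) _ (coefXn ly)); apply: etrans (coefB _ _ _) _.
exact: (congr2 (fun a b => a - b) (coef_expXY n w) (coefXn lx)).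
Qed.

Lemma homog_trace_poly n : homog n (trace_poly n).
Proof.
move=> w; rewrite coef_trace_poly; case: (size w =P n) => // wn.
have ne c : (nseq n c == w) = false by apply/eqP => E; apply: wn; rewrite -E size_nseq.
by rewrite !ne !subr0 eqxx.
Qed.

Lemma all_rot (T : Type) (p : pred T) k s : all p (rot k s) = all p s.
Proof. by rewrite /rot all_cat andbC -all_cat cat_take_drop. Qed.

Lemma rcons_nseq (T : eqType) n (c : T) : rcons (nseq n c) c = nseq n.+1 c.
Proof.
apply/eqP; rewrite eq_nseq size_rcons size_nseq eqxx all_rcons /= eqxx.
exact: all_pred1_nseq.
Qed.

Lemma rot_nseq (T : eqType) k n (c : T) : rot k (nseq n c) = nseq n c.
Proof.
by apply/eqP; rewrite eq_nseq size_rot size_nseq eqxx all_rot all_pred1_nseq.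
Qed.

Lemma rotsum_trace_poly n w : size w = n ->
  rotsum (trace_poly n) w =
  if all (pred1 lx) w || all (pred1 ly) w then 0 else n%:R.
Proof.
case: n => [/size0nil ->|n wn]; first by rewrite /rotsum big_ord0.
have term i : coef (trace_poly n.+1) (rot i w) =
    1 - (all (pred1 lx) w)%:R - (all (pred1 ly) w)%:R.
  rewrite coef_trace_poly size_rot wn eqxx ![nseq _ _ == _]eq_sym !eq_nseq.
  by rewrite !size_rot wn eqxx !all_rot.
rewrite /rotsum (eq_bigr _ (fun (i : 'I_(size w)) _ => term i)) sumr_const card_ord wn.
case: w wn {term} => [//|[] w] wn /=.
  by case: (all _ w); rewrite ?subr0 ?subrr ?mul0rn.
by rewrite orbF; case: (all _ w); rewrite ?subr0 ?subrr ?mul0rn.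
Qed.

(** * The words of Push(w) as cuts of the cyclic word wy *)

Lemma blocks_cat s t : blocks (s ++ t) = blocks s ++ blocks t.
Proof. by rewrite /blocks map_cat flatten_cat. Qed.

Lemma exps_word_rot s j : (j < size s)%N ->
  exps_word (rot j.+1 s) =
  blocks (drop j.+1 s) ++ blocks (take j s) ++ nseq (nth 0%N s j) lx.
Proof.
move=> js; apply: (@rcons_injl _ ly); rewrite rcons_exps_word; last first.
  by rewrite -size_eq0 size_rot -lt0n (leq_ltn_trans _ js).
by rewrite /rot blocks_cat (take_nth 0%N js) blocks_rcons -cats1 -!catA.
Qed.

(** Reindexes the positions of y by the blocks that they close. The prefix p is there for the
    induction, where blocks already passed accumulate. *)
Lemma sum_over_y_blocks (h : word -> word -> rat) p t :
  \sum_(i < size (blocks t)) (if nth lx (blocks t) i == ly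
     then h (blocks p ++ take i (blocks t)) (drop i.+1 (blocks t)) else 0) =
  \sum_(j < size t) h (blocks (p ++ take j t) ++ nseq (nth 0%N t j) lx)
                      (blocks (drop j.+1 t)).
Proof.
pose S pre w := \sum_(i < size w)
  (if nth lx w i == ly then h (pre ++ take i w) (drop i.+1 w) else 0).
have Scons pre c w : S pre (c :: w) = (if c == ly then h pre w else 0) + S (rcons pre c) w.
  rewrite /S /= big_ord_recl /= cats0 drop0; congr (_ + _).
  by apply: eq_bigr => i _; rewrite /bump /= cat_rcons.
have Sx pre a w : S pre (nseq a lx ++ w) = S (pre ++ nseq a lx) w.
  elim: a pre => [|a IH] pre; first by rewrite cats0.
  by rewrite /= Scons add0r IH cat_rcons.
rewrite -/(S (blocks p) (blocks t)).
elim: t p => [|a t IH] p; first by rewrite /S !big_ord0.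
have -> : blocks (a :: t) = nseq a lx ++ ly :: blocks t by rewrite /blocks /= -catA.
rewrite Sx Scons eqxx big_ord_recl /= cats0 drop0; congr (_ + _).
have -> : rcons (blocks p ++ nseq a lx) ly = blocks (rcons p a).
  by rewrite blocks_rcons -cats1 catA.
by rewrite IH; apply: eq_bigr => j _; rewrite cat_rcons.
Qed.

(** The members of Push(w) arise from the cyclic word of w y by removing one y and reading on from
    there; the appended y accounts for w itself. *)
Lemma sum_Push (g : word -> rat) w :
  \sum_(v <- Push w) g v =
  \sum_(i < (size w).+1) (if nth lx (rcons w ly) i == ly
     then g (drop i.+1 (rcons w ly) ++ take i (rcons w ly)) else 0).
Proof.
pose s := word_exps w; pose n := size s.
have iterE j : (j <= n)%N -> iter j push_word w = exps_word (rot (n - j) s).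
  elim: j => [_|j IH jn]; first by rewrite subn0 rot_size word_expsK.
  rewrite iterS (IH (ltnW jn)) /push_word exps_wordK; last first.
    by rewrite -size_eq0 size_rot size_word_exps.
  by rewrite -(subnSK jn) rotS ?rotK // ltn_subrL /= (leq_ltn_trans _ jn).
have -> : \sum_(v <- Push w) g v = \sum_(j < n) g (exps_word (rot j.+1 s)).
  rewrite /Push -size_word_exps -/s -/n (big_nth w) size_traject big_mkord.
  rewrite [RHS](reindex_inj rev_ord_inj); apply: eq_bigr => j _.
  by rewrite nth_traject // (iterE _ (ltnW (ltn_ord j))) [val _]/= subnSK.
rewrite -(size_rcons w ly) -(blocks_word_exps w).
rewrite (sum_over_y_blocks (fun u v => g (v ++ u)) [::] s).
by apply: eq_bigr => j _; rewrite exps_word_rot.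
Qed.

Lemma rotsum_special F G : dx F = 0 -> br X G + br Y F = 0 -> forall w,
  rotsum (rcof ly F * Y + rcof lx G * X) (rcons w ly) =
  \sum_(v <- Push w) coef (rcof ly F - rcof lx F) v.
Proof.
move=> dF /special_potential[H FGH] w.
set f := rcof ly F * Y + _.
have fE u c : coef f (rcons u c) = if c then coef F (rcons u ly) else coef G (rcons u lx).
  rewrite /f addrC; apply: etrans (coefD_mulr _ _ _ _) _.
  by case: c; rewrite coef_rcof.
have := coef_dx F w; rewrite dF coef0 => dF0.
(* The vanishing sum for [dx F] is added on the right, and the rotations are shifted so that the
   i-th one ends with the letter at position i. The identity then holds position by position. *)
rewrite sum_Push /rotsum -sum_rotS size_rcons -[RHS]addr0 [X in _ + X]dF0.
rewrite -big_split; apply: eq_bigr => i _ /=.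
have iw : (i <= size w)%N by rewrite -ltnS.
have gE u : coef (rcof ly F - rcof lx F) u = coef F (rcons u ly) - coef F (rcons u lx).
  apply: etrans (coefB _ _ _) _.
  exact: (congr2 (fun a b => a - b) (coef_rcof ly F u) (coef_rcof lx F u)).
have -> : rcons w ly = take i w ++ rcons (drop i w) ly by rewrite -rcons_cat cat_take_drop.
have [a sa] : exists a, a = take i w by exists (take i w).
have ia : nat_of_ord i = size a by rewrite sa size_takel.
move: (drop i w) => b; rewrite -sa ia.
rewrite nth_cat ltnn subnn take_size_cat // drop_cat.
rewrite (leq_gtF (leqnSn _)) subSnn.
case: b => [|l b].
  rewrite /= cats1 rot_oversize ?size_rcons // fE gE /=.
  by rewrite cats1 subrK.
rewrite rcons_cons /= drop0.
have -> : rot (size a).+1 (a ++ l :: rcons b ly) = rcons (rcons b ly ++ a) l.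
  by rewrite -cat_rcons -(size_rcons a l) rot_size_cat rcons_cat.
(* With a and b the parts of w around the letter l: for l = y, the term of [dx F] cancels the F_x
   part, by rotating its inserted x. For l = x there is no Push term, and the coefficient of G
   equals that of F at a x x b, which is the [dx] term. *)
rewrite fE; case: l => /=.
  rewrite gE !cat_rcons -[rcons (b ++ _) lx]cats1 -catA /= cats1.
  by rewrite (potential_rot FGH b (rcons a lx)) cat_rcons subrK.
by rewrite add0r rcons_cat cat_rcons (potential_swap FGH) cat_rcons.
Qed.

Lemma push_constant_trace n F G : (1 < n)%N -> lie_poly F -> lie_poly G ->
  homog n F -> homog n G -> br X G + br Y F = 0 ->
  push_constant n.-1 (rcof ly F - rcof lx F) <->
  exists A : rat, tr (rcof ly F * Y + rcof lx G * X)
                  = A *: tr ((X + Y) ^+ n - X ^+ n - Y ^+ n).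
Proof.
move=> n1 LF LG Fn Gn sp.
have [H FGH] := special_potential sp.
have dF : dx F = 0 by apply: lie_dx_eq0 LF Fn _; rewrite gtn_eqF.
case: n n1 Fn Gn => // m m0 Fn Gn; rewrite [_.+1.-1]/=.
rewrite -/(trace_poly m.+1); set f := rcof ly F * Y + _.
have fn : homog m.+1 f.
  apply: homogD; apply: homog_mulr => w; rewrite coef_rcof.
    by move/Fn; rewrite size_rcons => -[].
  by move/Gn; rewrite size_rcons => -[].
have trE A : tr f = A *: tr (trace_poly m.+1) <->
    forall w, size w = m.+1 -> rotsum f w = A * rotsum (trace_poly m.+1) w.
  have -> : A *: tr (trace_poly m.+1) = tr (A *: trace_poly m.+1) by apply: TR_scale_tr.
  have rZ w : rotsum (A *: trace_poly m.+1) w = A * rotsum (trace_poly m.+1) w.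
    rewrite /rotsum mulr_sumr; apply: eq_bigr => i _; exact: coefZ.
  have An : homog m.+1 (A *: trace_poly m.+1).
    by have := @homog_lin _ A _ _ (@homog_trace_poly m.+1) (@homog0 m.+1); rewrite addr0.
  rewrite (tr_eqP (ltn0Sn m) fn An).
  by split=> E w wn; have := E w wn; rewrite rZ.
have m1 : m.+1 != 1%N by rewrite gtn_eqF.
have allr w c : all (pred1 c) (rcons w ly) = (c == ly) && all (pred1 c) w.
  by rewrite all_rcons /= eq_sym.
have rE w : size w = m -> rotsum (trace_poly m.+1) (rcons w ly)
    = if w == nseq m ly then 0 else m.+1%:R.
  by move=> wm; rewrite rotsum_trace_poly ?size_rcons ?wm // !allr /= eq_nseq wm eqxx.
split=> [[_ [A pc]]|[A /trE trA]].
  (* The rotation sum of the trace polynomial is the length m+1 on every word that is not a power of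
     a letter. *)
  exists (A / m.+1%:R); apply/trE => w wn; rewrite rotsum_trace_poly //.
  have fnseq c : all (pred1 c) w -> rotsum f w = 0.
    move/all_pred1P => ->; rewrite wn /rotsum big1 // => i _.
    rewrite rot_nseq -rcons_nseq /f addrC; apply: etrans (coefD_mulr _ _ _ _) _.
    by case: (c); rewrite coef_rcof rcons_nseq; apply: lie_coef_nseq.
  have [/fnseq ->|wx] := boolP (all (pred1 lx) w); first by rewrite mulr0.
  have [/fnseq ->|wy] := boolP (all (pred1 ly) w); first by rewrite mulr0.
  rewrite divfK ?Num.Theory.pnatr_eq0 //.
  (* A mixed word can be rotated to end in y, where [rotsum_special] applies; the remaining word is
     not y^m, since otherwise w would be a power of y. *)
  have yw : ly \in w.
    apply: contraR wx => yw; apply/allP => c cw /=.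
    by case: c cw => // cw; rewrite cw in yw.
  case/splitPr: yw wn wy {wx fnseq} => p q wn wy.
  have rw : rot (size p).+1 (p ++ ly :: q) = rcons (q ++ p) ly.
    by rewrite -cat_rcons -(size_rcons p ly) rot_size_cat rcons_cat.
  have qp : size (q ++ p) = m.
    by apply/eqP; rewrite -eqSS -wn !size_cat /= addnS addnC.
  rewrite -(rotsum_rot f (size p).+1) rw rotsum_special // pc //.
  apply: contra wy => /eqP E; rewrite -(all_rot _ (size p).+1) rw E.
  by rewrite all_rcons /= all_pred1_nseq.
split.
  (* Both coefficients vanish: (F | y^(m+1)) because F is Lie, and (F | y^m x) because it equals (G
     | y^(m+1)) with G Lie. *)
  rewrite coefB !coef_rcof rcons_nseq -cats1.
  rewrite -(potential_swap FGH (nseq m ly) [::]) /= -[ly :: _]/(nseq m.+1 ly).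
  by rewrite !lie_coef_nseq ?subrr.
exists (A * m.+1%:R) => w wm wy.
by rewrite -(rotsum_special dF sp) trA ?size_rcons ?wm // rE // (negPf wy).
Qed.

(** * Special derivations *)

Lemma span_ind (V : lmodType rat) (S P : V -> Prop) :
  P 0 -> (forall a u v, P u -> P v -> P (a *: u + v)) -> (forall u, S u -> P u) ->
  forall v, v \in Defs.span S -> P v.
Proof.
move=> P0 PD PS v /asboolP[k [c [u [Su ->]]]].
by elim/big_rec: _ => // i x _; apply/PD/PS/Su.
Qed.

Lemma spanT_valP (V : lmodType rat) (S : V -> Prop) (u : spanT S) :
  spanT_val u \in Defs.span S.
Proof. by case: u. Qed.

Lemma spanT_val_inj (V : lmodType rat) (S : V -> Prop) :
  injective (@spanT_val V S).
Proof. exact: val_inj. Qed.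

Lemma lie_val_lin (a : rat) (F G : Lie) :
  lie_val (a *: F + G) = a *: lie_val F + lie_val G.
Proof. by []. Qed.

Lemma lie_val_inj : injective lie_val.
Proof. exact: val_inj. Qed.

Lemma der_lie v f : (forall c, lie_poly (v c)) -> lie_poly f -> lie_poly (der v f).
Proof.
move=> Lv; elim=> [||a p q _ IHp _ IHq|p q Lp IHp Lq IHq].
- by rewrite der_mon1.
- by rewrite der_mon1.
- by rewrite der_linear; apply: lie_lin.
by rewrite der_br; apply: lie_polyD; apply: lie_br.
Qed.

Lemma lmod_lin_comb (V : lmodType rat) (a b c : rat) (t u v : V) :
  a *: (b *: t + u) + (c *: t + v) = (a * b + c) *: t + (a *: u + v).
Proof. by rewrite scalerDr scalerA addrACA -scalerDl. Qed.

Lemma ring_der_lin (A : lalgType rat) (a : rat) (p q m x d e : A) :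
  (forall (a : rat) (u v : A), u * (a *: v) = a *: (u * v)) ->
  (a *: p + q) * m + x * (a *: d + e) = a *: (p * m + x * d) + (q * m + x * e).
Proof. by move=> Zr; rewrite mulrDl mulrDr Zr -scalerAl addrACA scalerDr. Qed.

Lemma der_lin v v1 v2 (a : rat) : (forall c, v c = a *: v1 c + v2 c) ->
  forall f, der v f = a *: der v1 f + der v2 f.
Proof.
move=> vE; apply: linear_mon_ext; first exact: der_linear.
  move=> b f g; rewrite (der_linear v1 b f g) (der_linear v2 b f g).
  exact: lmod_lin_swap.
move=> w; rewrite /der !linext_mon; elim: w => [|c w IH] /=.
  by rewrite scaler0 addr0.
by rewrite IH vE; apply: ring_der_lin mulZr.
Qed.

Lemma der_fun0 f : der (fun=> 0) f = 0.
Proof.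
have d0 := @der_lin (fun=> 0) (fun=> 0) (fun=> 0) (-1).
by rewrite d0 ?scaleN1r ?addNr // => c; rewrite scaleN1r addNr.
Qed.

Definition der_values (F G : Qxy) (c : letter) : Qxy :=
  if c then br Y F else br X G.

Lemma der_values_lie F G c : lie_poly F -> lie_poly G -> lie_poly (der_values F G c).
Proof.
by case: c => LF LG; [exact: lie_br lie_Y LF|exact: lie_br lie_X LG].
Qed.

Definition lieDer (F G K : Lie) : Lie :=
  MkLie (asboolT (der_lie (fun c => der_values_lie c (lieP F) (lieP G)) (lieP K))).

Lemma lieDer_is_Der F G : is_Der F G (lieDer F G).
Proof.
split; first split.
- by move=> a K L; apply: lie_val_inj; apply: der_linear.
- by move=> K L; apply: lie_val_inj; apply: der_br.
- by apply: lie_val_inj; apply: der_mon1.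
by apply: lie_val_inj; apply: der_mon1.
Qed.

Lemma lie_derivation_ext D D' : lie_derivation D -> lie_derivation D' ->
  D LX = D' LX -> D LY = D' LY -> D = D'.
Proof.
move=> [Dl Db] [Dl' Db'] DX DY; apply: funext => K.
(* The induction runs on the proof that the underlying polynomial is Lie, so the element of [Lie]
   carrying it is quantified. *)
suff ext f : lie_poly f -> forall L : Lie, lie_val L = f -> D L = D' L.
  exact: ext (lieP K) K (erefl _).
elim=> [||a p q Lp IHp Lq IHq|p q Lp IHp Lq IHq] L LE.
- by have -> : L = LX by apply: lie_val_inj.
- by have -> : L = LY by apply: lie_val_inj.
- pose P := MkLie (asboolT Lp); pose Q := MkLie (asboolT Lq).
  have -> : L = a *: P + Q by apply: lie_val_inj.
  by rewrite Dl Dl' (IHp P (erefl _)) (IHq Q (erefl _)).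
pose P := MkLie (asboolT Lp); pose Q := MkLie (asboolT Lq).
have -> : L = Lbr P Q by apply: lie_val_inj.
by rewrite Db Db' (IHp P (erefl _)) (IHq Q (erefl _)).
Qed.

Lemma is_Der_unique F G D : is_Der F G D -> D = lieDer F G.
Proof.
move=> [Dd DX DY]; have [Ed EX EY] := lieDer_is_Der F G.
by apply: lie_derivation_ext; rewrite ?DX ?DY.
Qed.

Lemma specialP (F G : Lie) : special F G <-> br X G + br Y F = 0.
Proof.
split=> [/(congr1 lie_val) //|sp]; exact: lie_val_inj.
Qed.

(** D_{F,G} with G = s(F^x), defined for arbitrary F and linear in F, so that it needs no
    decomposition of F into generators. *)
Definition kvDer (F : Qxy) : Qxy -> Qxy := der (der_values F (s_map (lcof lx F))).

Lemma der_values_lin a F F' G G' c :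
  der_values (a *: F + F') (a *: G + G') c =
  a *: der_values F G c + der_values F' G' c.
Proof. by case: c; apply: br_linearr. Qed.

Lemma kvDer_lin a F F' f : kvDer (a *: F + F') f = a *: kvDer F f + kvDer F' f.
Proof.
rewrite /kvDer lcof_linear smap_linear; apply: der_lin => c; exact: der_values_lin.
Qed.

Lemma kvDer0 f : kvDer 0 f = 0.
Proof.
by have := kvDer_lin (-1) 0 0 f; rewrite scaler0 addr0 scaleN1r addNr.
Qed.

Lemma kv_gen_Der n (F : Lie) : (2 < n)%N -> kv_gen n F ->
  exists G : Lie, [/\ homog n G, lie_val G = s_map (lcof lx F) &
                      krv2_gen n (lieDer F G)].
Proof.
move=> n2 [Fn ap pc]; have n1 := ltnW n2; have LF := lieP F.
have [LG Gn sp] := lie_smap n1 LF Fn ((antipalindromicP LF Fn).1 ap).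
exists (MkLie (asboolT LG)); split=> //.
exists F, (MkLie (asboolT LG)); split=> //.
- exact: lieDer_is_Der.
- exact/specialP.
exact/(push_constant_trace n1 LF LG Fn Gn sp).
Qed.

Lemma krv2_gen_kv n D : (2 < n)%N -> krv2_gen n D ->
  exists F : Lie, kv_gen n F /\ forall K, lie_val (D K) = kvDer F K.
Proof.
move=> n2 [F [G [Fn Gn DFG /specialP sp trA]]]; have n1 := ltnW n2.
have [LF LG] := (lieP F, lieP G).
exists F; split; first split=> //.
- exact/(antipalindromic_push n1 LF Fn)/(special_push_invariant sp).
- exact/(push_constant_trace n1 LF LG Fn Gn sp).
by move=> K; rewrite (is_Der_unique DFG) /kvDer -(special_smap n1 LG Gn sp).
Qed.

(** Cyclicity gives (F|xy) = (F|yx), reversal symmetry of Lie polynomials gives the opposite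
    sign. *)
Lemma special_deg2 F G : lie_poly F -> homog 2 F -> br X G + br Y F = 0 -> F = 0.
Proof.
move=> LF Fn /special_potential[H FGH].
have Fsw : coef F [:: lx; ly] = coef F [:: ly; lx] := potential_rcofF FGH [:: lx].
have Fxy : coef F [:: lx; ly] = 0.
  have := lie_coef_rev [:: lx; ly] LF; rewrite /= sqrrN expr1n mul1r Fsw.
  move/eqP; rewrite -addr_eq0 -mulr2n Num.Theory.mulrn_eq0 => /eqP.
  by [].
apply: (homog_ext Fn (@homog0 2)) => -[|l [|l' [|]]] // _; rewrite coef0.
by case: l l' => [] []; rewrite -?Fsw ?Fxy //;
  [exact: (@lie_coef_nseq F 2 ly LF)|exact: (@lie_coef_nseq F 2 lx LF)].
Qed.

Lemma krv2_gen_kvDer n D : (2 <= n)%N -> krv2_gen n D ->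
  exists2 F : Lie, F \in Defs.span (fun F : Lie => exists2 n, (3 <= n)%N & kv_gen n F)
    & forall K, lie_val (D K) = kvDer F K.
Proof.
rewrite leq_eqVlt => /orP[/eqP <-|n2 /(krv2_gen_kv n2)[F [Fkv DE]]]; last first.
  by exists F => //; apply: span_gen; exists n.
move=> [F [G [Fn Gn DFG /specialP sp _]]].
have F0 : F = 0 by apply: lie_val_inj; apply: special_deg2 (lieP F) Fn sp.
exists F; first by rewrite F0; apply: rpred0.
by move=> K; rewrite (is_Der_unique DFG) /kvDer -(special_smap (ltnSn 1) (lieP G) Gn sp).
Qed.

Lemma kvDer_span (F : Vkv) : exists D : krv2_from 2,
  forall K, lie_val (spanT_val D K) = kvDer (spanT_val F) K.
Proof.
suff [D DS DE] : exists2 D : Lie -> Lie,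
    D \in Defs.span (fun D => exists2 n, (2 <= n)%N & krv2_gen n D) &
    forall K, lie_val (D K) = kvDer (spanT_val F) K by exists (SpanT DS).
move: (spanT_valP F); move: (spanT_val F).
apply: span_ind => [|a u v [D DS DE] [D' DS' DE']|u [n n3 ukv]].
- by exists 0; [exact: rpred0|move=> K; rewrite [RHS]kvDer0].
- exists (a *: D + D'); first by apply: rpredD DS'; apply: rpredZ.
  by move=> K; rewrite [RHS]kvDer_lin -DE -DE'.
have [G [Gn GE Dgen]] := kv_gen_Der n3 ukv.
exists (lieDer u G); first by apply: span_gen; exists n => //; apply: ltnW.
by move=> K; rewrite /kvDer -GE.
Qed.

(** The choice is harmless: an element of [krv2_from 2] is determined by its values, which [kvDer]
    prescribes. *)
Definition kvIso (F : Vkv) : krv2_from 2 := projT1 (cid (kvDer_span F)).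

Lemma kvIsoE F K : lie_val (spanT_val (kvIso F) K) = kvDer (spanT_val F) K.
Proof. exact: (projT2 (cid (kvDer_span F))). Qed.

Lemma kvIso_unique (F : Vkv) (D : krv2_from 2) :
  (forall K, lie_val (spanT_val D K) = kvDer (spanT_val F) K) -> kvIso F = D.
Proof.
move=> DE; apply: spanT_val_inj; apply: funext => K; apply: lie_val_inj.
by rewrite kvIsoE DE.
Qed.

Lemma kvIso_linear : linear kvIso.
Proof.
move=> a F F'; apply: kvIso_unique => K.
by rewrite [RHS]kvDer_lin -!kvIsoE.
Qed.

HB.instance Definition _ :=
  GRing.isLinear.Build rat Vkv (krv2_from 2) *:%R kvIso kvIso_linear.

Lemma Vkv_coef_nseq (F : Vkv) m c : coef (spanT_val F) (nseq m c) = 0.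
Proof.
move: (spanT_valP F); move: (spanT_val F).
apply: span_ind => [|a u v IHu IHv|u [n n3 [un _ _]]]; first exact: coef0.
  by rewrite lie_val_lin coefP IHu IHv mulr0 addr0.
have [->|m1] := eqVneq m 1%N; last exact: lie_coef_nseq (lieP u) m1.
by rewrite (homog_coef un) //= ltn_eqF // ltnW.
Qed.

(** Evaluating at y gives [y, F - F'] = 0, so F - F' is a polynomial in y alone; elements of V_kv
    contain no power of y. *)
Lemma kvIso_inj : injective kvIso.
Proof.
move=> F F' FF'; apply: spanT_val_inj; apply: lie_val_inj.
apply/eqP; rewrite -subr_eq0; apply/eqP; apply: (@br_letter_inj ly) => [|m].
  apply: etrans (brB _ _ _) _; apply/eqP; rewrite subr_eq0; apply/eqP.
  have valY (E : Vkv) : lie_val (spanT_val (kvIso E) LY) = br Y (spanT_val E).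
    by rewrite kvIsoE; apply: der_mon1.
  have E := congr1 (fun D : krv2_from 2 => lie_val (spanT_val D LY)) FF'.
  exact: etrans (esym (valY F)) (etrans E (valY F')).
apply: etrans (coefB _ _ _) _.
exact: etrans (congr2 (fun a b => a - b) (Vkv_coef_nseq F m ly) (Vkv_coef_nseq F' m ly))
  (subrr 0).
Qed.

Lemma kvIso_surj (D : krv2_from 2) : exists F, kvIso F = D.
Proof.
suff [F FS DE] : exists2 F : Lie,
    F \in Defs.span (fun F : Lie => exists2 n, (3 <= n)%N & kv_gen n F) &
    forall K, lie_val (spanT_val D K) = kvDer F K.
  by exists (SpanT FS); apply: kvIso_unique.
move: (spanT_valP D); move: (spanT_val D).
apply: span_ind => [|a D1 D2 [F1 S1 E1] [F2 S2 E2]|{}D [n n2 Dn]].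
- by exists 0; [exact: rpred0|move=> K; rewrite [RHS]kvDer0].
- exists (a *: F1 + F2); first by apply: rpredD S2; apply: rpredZ.
  by move=> K; rewrite [RHS]kvDer_lin -E1 -E2.
exact: krv2_gen_kvDer n2 Dn.
Qed.

Lemma kvIso_bij : bijective kvIso.
Proof.
pose inv D := projT1 (cid (kvIso_surj D)).
have invK D : kvIso (inv D) = D := projT2 (cid (kvIso_surj D)).
by exists inv => // F; apply: kvIso_inj; rewrite invK.
Qed.

(** * The degree 1 part of the Kashiwara-Vergne Lie algebra *)

Lemma homog_letter c : homog 1 (mon [:: c]).
Proof.
by move=> w; rewrite coef_mon; case: ([:: c] =P w) => [<- //|_]; rewrite eqxx.
Qed.

Lemma krv2_gen1_lieDer : krv2_gen 1 (lieDer LX LY).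
Proof.
exists LX, LY; split.
- exact: homog_letter.
- exact: homog_letter.
- exact: lieDer_is_Der.
- by apply/specialP; rewrite [br X _]brN addNr.
(* The right-hand trace is 0 for n = 1 in any case, and the left side vanishes because x does not
   end in y nor y in x. *)
exists 0; rewrite scale0r.
have -> : rcof ly LX = 0.
  apply: coef_ext => w; rewrite coef_rcof coef_mon coef0 -[[:: _]]/(rcons [::] _).
  by rewrite eqseq_rcons andbF.
have -> : rcof lx LY = 0.
  apply: coef_ext => w; rewrite coef_rcof coef_mon coef0 -[[:: _]]/(rcons [::] _).
  by rewrite eqseq_rcons andbF.
by rewrite !mul0r addr0 raddf0.
Qed.

Lemma homog1E F : homog 1 F -> F = coef F [:: lx] *: X + coef F [:: ly] *: Y.
Proof.
move=> F1; apply: (homog_ext F1) => [|[|l []] // _].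
  apply: homog_lin (@homog_letter lx) _; rewrite -[coef F [:: ly] *: Y]addr0.
  exact: homog_lin (@homog_letter ly) (@homog0 1).
apply: esym; apply: etrans (coefP _ _ _ _) _.
apply: etrans (congr1 _ (coefZ _ _ _)) _; rewrite (coef_mon [:: lx]) (coef_mon [:: ly]).
by case: l; rewrite /= ?mulr0 ?mulr1 ?addr0 ?add0r.
Qed.

(** In [x,G] and [y,F] only the y-part of G and the x-part of F survive, and the coefficient of xy
    in the special equation makes these equal. *)
Lemma krv2_gen1 D : krv2_gen 1 D -> exists a : rat, D = a *: lieDer LX LY.
Proof.
move=> [F [G [F1 G1 DFG /specialP sp _]]]; exists (coef F [:: lx]).
have brXG : br X G = coef G [:: ly] *: br X Y.
  rewrite {1}(homog1E G1); apply: etrans (br_linearr X _ _ _) _.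
  apply: etrans (congr2 +%R (etrans (congr1 _ (brxx X)) (scaler0 _ _)) (brZ X _ Y)) _.
  exact: add0r.
have brYF : br Y F = coef F [:: lx] *: br Y X.
  rewrite {1}(homog1E F1); apply: etrans (br_linearr Y _ _ _) _.
  apply: etrans (congr1 _ (etrans (brZ Y _ Y) (congr1 _ (brxx Y)))) _.
  exact: etrans (congr1 _ (scaler0 _ _)) (addr0 _).
have FG : coef F [:: lx] = coef G [:: ly].
  apply/eqP; rewrite eq_sym -subr_eq0; apply/eqP.
  rewrite -[RHS](coef0 [:: lx; ly]) -sp; apply: esym; apply: etrans (coefD _ _ _) _.
  apply: etrans (congr2 +%R (coef_br_letter lx G lx [::] ly)
    (coef_br_letter ly F lx [::] ly)) _.
  by rewrite /= subr0 sub0r.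
apply: funext => K; apply: lie_val_inj; rewrite (is_Der_unique DFG).
apply: etrans (@der_lin _ (der_values LX LY) (fun=> 0) (coef F [:: lx]) _ _) _.
  case; first exact: etrans brYF (esym (addr0 _)).
  by rewrite FG; exact: etrans brXG (esym (addr0 _)).
exact: etrans (congr1 _ (der_fun0 _)) (addr0 _).
Qed.

(** This coefficient equals 1 for D_{x,y}, so it isolates the degree 1 component and yields
    uniqueness of the splitting. *)
Lemma krv2_from2_LX (E : krv2_from 2) : coef (lie_val (spanT_val E LX)) [:: lx; ly] = 0.
Proof.
move: (spanT_valP E); move: (spanT_val E).
apply: span_ind => [|a D D' IH IH'|D [n n2 [F [G [_ Gn [_ DX _] _ _]]]]].
- exact: coef0.
- by rewrite lie_val_lin coefP IH IH' mulr0 addr0.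
rewrite DX; apply: etrans (coef_br_letter lx G lx [::] ly) _ => /=.
by rewrite subr0 (homog_coef Gn) // ltn_eqF.
Qed.

Theorem theorem1p2 :
  (forall (n : nat) (F : Lie), (3 <= n)%N -> homog n F ->
     (antipalindromic n.-1 (rcof ly F) <-> push_invariant F)) /\
  (exists Phi : {linear Vkv -> krv2_from 2},
     bijective Phi /\
     forall (n : nat) (F : Vkv), (3 <= n)%N -> kv_gen n (spanT_val F) ->
       exists G : Lie,
         [/\ homog n G,
             lie_val G = s_map (lcof lx (spanT_val F)) &
             is_Der (spanT_val F) G (spanT_val (Phi F))]) /\
  (exists T : krv2,
     is_Der LX LY (spanT_val T) /\
     (forall D : krv2, exists! p : rat * krv2_from 2,
        spanT_val D = p.1 *: spanT_val T + spanT_val p.2)).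
Proof.
split; [|split].
- by move=> n F n3; apply: antipalindromic_push (ltnW n3) (lieP F).
- exists kvIso; split; first exact: kvIso_bij.
  move=> n F n3 Fkv; have [G [Gn GE _]] := kv_gen_Der n3 Fkv.
  exists G; split=> //.
  have -> : spanT_val (kvIso F) = lieDer (spanT_val F) G.
    by apply: funext => K; apply: lie_val_inj; rewrite kvIsoE /kvDer -GE.
  exact: lieDer_is_Der.
have TS : lieDer LX LY \in
    Defs.span (fun D : Lie -> Lie => exists2 n, (1 <= n)%N & krv2_gen n D).
  by apply: span_gen; exists 1%N => //; apply: krv2_gen1_lieDer.
exists (SpanT TS); split; first exact: lieDer_is_Der.
move=> D.
have [a [E DE]] : exists a (E : krv2_from 2),
    spanT_val D = a *: lieDer LX LY + spanT_val E.
  move: (spanT_valP D); move: (spanT_val D).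
  apply: span_ind => [|a D1 D2 [a1 [E1 ->]] [a2 [E2 ->]]|{}D [n n1 Dn]].
  - by exists 0, 0; rewrite scale0r add0r.
  - by exists (a * a1 + a2), (a *: E1 + E2); apply: lmod_lin_comb.
  have [n2|n2] := leqP 2 n; last first.
    have En : n = 1%N by apply/eqP; rewrite eqn_leq n1 -ltnS n2.
    rewrite En in Dn; have [a ->] := krv2_gen1 Dn.
    by exists a, 0; rewrite addr0.
  have DS : D \in Defs.span (fun D => exists2 n, (2 <= n)%N & krv2_gen n D).
    by apply: span_gen; exists n.
  by exists 0, (SpanT DS); rewrite scale0r add0r.
exists (a, E); split=> // -[a' E'] /= E'D.
(* Compare the coefficient of xy in D(x): the parts of degree at least 2 contribute nothing. *)
have aa' : a = a'.
  have TX : coef (lie_val (lieDer LX LY LX)) [:: lx; ly] = 1.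
    have [_ -> _] := lieDer_is_Der LX LY.
    by rewrite /= /br coefB !monM !coef_mon subr0.
  have := congr1 (fun D : Lie -> Lie => coef (lie_val (D LX)) [:: lx; ly])
    (etrans (esym DE) E'D).
  rewrite -![lie_val ((_ + _) _)]/(lie_val (_ *: _ + _)) !lie_val_lin !coefP.
  by rewrite !krv2_from2_LX TX !mulr1 !addr0.
congr (_, _) => //; apply: spanT_val_inj.
by move: E'D; rewrite DE aa' => /addrI.
Qed.
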